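(* Let $\tilde\gamma>0$, $\tilde\mu>0$, $\tilde\beta\in\mathbb R$, and let $\psi(t)=(\tilde\beta/\tilde\mu)\,(e^{\tilde\beta t}-1)^{-1}$ for $t>0$ (read as the limit $1/(\tilde\mu t)$ when $\tilde\beta=0$). The transition density $h(x,t)$ described in the context is given by $$h(x,t)=\frac{[\psi(t)]^{\tilde\gamma}}{\Gamma(\tilde\gamma)}\,x^{\tilde\gamma-1}e^{-x\psi(t)},\qquad x\in\mathbb R^+,\ t>0.$$
   Context: $\mathbb R^+=(0,\infty)$. For each $t>0$, $h(\cdot,t)$ is a probability density on $\mathbb R^+$: the transition density, started from state $0$, of the temporally homogeneous diffusion on $\mathbb R^+$ with drift $\tilde\beta x+\tilde\gamma\tilde\mu$ and infinitesimal variance $2\tilde\mu x$ with zero-flux condition at $x=0$. That is, $h$ satisfies, for $x\in\mathbb R^+$ and $t>0$, the Fokker–Planck equation $$\frac{\partial}{\partial t}h(x,t)=-\frac{\partial}{\partial x}\left\{(\tilde\beta x+\tilde\gamma\tilde\mu)h(x,t)\right\}+\frac12\frac{\partial^2}{\partial x^2}\left\{2\tilde\mu x\,h(x,t)\right\},$$ with boundary condition $$\lim_{x\to0^+}\left\{(\tilde\beta x+\tilde\gamma\tilde\mu)h(x,t)-\frac12\frac{\partial}{\partial x}\left[2\tilde\mu x\,h(x,t)\right]\right\}=0$$ and initial condition $\lim_{t\to0^+}h(x,t)=\delta(x)$ (the Dirac delta at $0$, i.e. weak convergence of the corresponding probability measures to the unit mass at $0$). *)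

(* Defs.v *)
From HB Require Import structures.
From mathcomp Require Import all_boot all_order all_algebra.
From mathcomp Require Import all_classical all_reals all_analysis.
Import Order.TTheory GRing.Theory Num.Theory.
Import numFieldNormedType.Exports.
Set Implicit Arguments.
Unset Strict Implicit.
Unset Printing Implicit Defensive.
Local Open Scope ring_scope.
Local Open Scope classical_set_scope.

(* In this file h x t is only constrained for x > 0 and t > 0: x is the state
   and t the time. *)

Definition Gamma {R : realType} (a : R) : R :=
  \int[lebesgue_measure]_(x in `]0, +oo[) (x `^ (a - 1) * expR (- x)).

Definition psi {R : realType} (beta mu t : R) : R :=
  if beta == 0 then (mu * t)^-1 else beta / mu * (expR (beta * t) - 1)^-1.

Definition is_density {R : realType} (f : R -> R) : Prop :=
  [/\ measurable_fun (`]0, +oo[ : set R) f,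
      forall x : R, 0 < x -> 0 <= f x &
      (\int[lebesgue_measure]_(x in `]0%R, +oo[) (f x)%:E = 1)%E].

(* Regularity of a classical solution of a second-order parabolic equation on
   the open quadrant: continuous, together with its first time derivative and
   its first two space derivatives, as functions of the pair (x, t). *)
Definition C21 {R : realType} (h : R -> R -> R) : Prop :=
  forall x t : R, 0 < x -> 0 < t ->
  [/\ derivable (h x) t 1,
      derivable (h ^~ t) x 1 &
      derivable (derive1 (h ^~ t)) x 1] /\
  [/\ {for (x, t), continuous (fun p : R * R => h p.1 p.2)},
      {for (x, t), continuous (fun p : R * R => derive1 (h p.1) p.2)},
      {for (x, t), continuous (fun p : R * R => derive1 (h ^~ p.2) p.1)} &
      {for (x, t), continuous (fun p : R * R => derive1n 2 (h ^~ p.2) p.1)}].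

Definition fokker_planck {R : realType} (beta gamma mu : R) (h : R -> R -> R)
    : Prop :=
  forall x t : R, 0 < x -> 0 < t ->
  derive1 (h x) t =
    - derive1 (fun y => (beta * y + gamma * mu) * h y t) x
    + 2^-1 * derive1n 2 (fun y => 2 * mu * y * h y t) x.

Definition zero_flux {R : realType} (beta gamma mu : R) (h : R -> R -> R)
    : Prop :=
  forall t : R, 0 < t ->
  ((beta * x + gamma * mu) * h x t
    - 2^-1 * derive1 (fun y => 2 * mu * y * h y t) x) @[x --> 0^'+] --> 0.

(* Weak convergence of the laws h(x, t) dx to the unit mass at 0 as t -> 0+. *)
Definition starts_at_0 {R : realType} (h : R -> R -> R) : Prop :=
  forall f : R -> R, continuous f -> (exists M : R, forall x : R, `|f x| <= M) ->
  (\int[lebesgue_measure]_(x in `]0, +oo[) (f x * h x t)) @[t --> 0^'+] --> f 0.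

Record transition_density_from_0 {R : realType} (beta gamma mu : R)
    (h : R -> R -> R) : Prop := TransitionDensityFrom0 {
  td_density : forall t : R, 0 < t -> is_density (h ^~ t);
  td_regular : C21 h;
  td_fokker_planck : fokker_planck beta gamma mu h;
  td_zero_flux : zero_flux beta gamma mu h;
  td_initial : starts_at_0 h }.

(* Main.v *)
(* Uniqueness.  Let [L] be the generator.  If [a' = mu a^2 - beta a] and
   [b' = gamma mu a b], then [theta x t = b t * (1 - expR (- (a t * x)))] satisfies
   [(d/dt + L) theta = b'].  Since [theta] vanishes to first order at [x = 0], a
   cut-off at scale [e] near [0] and [1/e] near infinity perturbs
   [(d/dt + L) theta] only by bounded terms that vanish pointwise as [e -> 0].
   Testing the equation against the cut-off [theta] and using dominated
   convergence, first in [x] against the probability density [h], then in [t], gives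
   [\int theta h] at time [t2] minus the same at [t1] equal to [b t2 - b t1].
   As [h] has mass [1], [b t * \int expR (- (a t * x)) h x t dx] is constant in [t].
   Ending at [(a, b) = (s, 1)] and letting [t -> 0] in the
   initial condition determines the Laplace transform of [h], hence [h].

   Existence is a computation resting on [(1/psi)' = mu + beta/psi] and on the
   first moment [gamma/psi], which tends to [0] with [t]. *)
Require Import Defs.
From HB Require Import structures.
From mathcomp Require Import all_boot all_order all_algebra.
From mathcomp Require Import all_classical all_reals all_analysis.
From mathcomp Require Import measurable_realfun.
From mathcomp Require Import ring lra.
Import Order.TTheory GRing.Theory Num.Theory.
Import numFieldNormedType.Exports.
Local Open Scope ring_scope.
Local Open Scope classical_set_scope.
Set Implicit Arguments.
Unset Strict Implicit.
Unset Printing Implicit Defensive.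

(** * Differentiation and continuity rules *)

(** The definition of a transition density contains no bound on [h] or its derivatives, uniform in
    time, near [x = 0] or at infinity. So the equation is tested on compact intervals only, and
    every domination comes from the mass of [h]. This dictates the test function. The generator has
    coefficients affine in [x], so [b t * expR (- (a t * x))] solves the backward equation; but a
    cut-off would multiply it by a term of order 1/x near [0], which the mass of [h] cannot
    dominate. Subtracting it from [b t] removes its value at [x = 0], at the price of the explicit
    source b', constant in [x].

    The Laplace transform of the gamma density is never computed by integration: existence makes the
    gamma density a transition density, and any two of these are compared. They are compared at
    natural arguments only, that is, through the moments of exp(-x), so injectivity becomes a
    statement about polynomials on [0, 1]. *)

Section calculus_rules.
Context {R : realType}.
Implicit Types (f g : R -> R) (x c df dg : R).

Lemma derive_rule_cst x c : is_derive x 1 (fun=> c) 0.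
Proof. exact: is_derive_cst. Qed.

Lemma derive_rule_id x : is_derive x 1 (fun y => y) 1.
Proof. exact: is_derive_id. Qed.

Lemma derive_ruleD f g x df dg : is_derive x 1 f df -> is_derive x 1 g dg ->
  is_derive x 1 (fun y => f y + g y) (df + dg).
Proof. by move=> ? ?; exact: is_deriveD. Qed.

Lemma derive_ruleN f x df : is_derive x 1 f df -> is_derive x 1 (fun y => - f y) (- df).
Proof. by move=> ?; exact: is_deriveN. Qed.

Lemma derive_ruleM f g x df dg : is_derive x 1 f df -> is_derive x 1 g dg ->
  is_derive x 1 (fun y => f y * g y) (f x * dg + g x * df).
Proof. by move=> ? ?; exact: is_deriveM. Qed.

Lemma derive_ruleV f x df : f x != 0 -> is_derive x 1 f df ->
  is_derive x 1 (fun y => (f y)^-1) (- (f x ^- 2 * df)).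
Proof. by move=> fx ?; rewrite -mulNr; exact: is_deriveV. Qed.

Lemma derive_ruleX f x df n : is_derive x 1 f df ->
  is_derive x 1 (fun y => f y ^+ n) (n%:R * f x ^+ n.-1 * df).
Proof. by move=> ?; rewrite -[X in is_derive _ _ X](exprfctE f n); exact: is_deriveX. Qed.

Lemma derive_rule_expR f x df : is_derive x 1 f df ->
  is_derive x 1 (fun y => expR (f y)) (expR (f x) * df).
Proof. by move=> ?; exact: is_derive1_comp. Qed.

Lemma derive_rule_powR f x df c : 0 < f x -> is_derive x 1 f df ->
  is_derive x 1 (fun y => f y `^ c) (c * f x `^ (c - 1) * df).
Proof. by move=> fx0 ?; apply: (@is_derive1_comp R (fun y => y `^ c)); exact: is_derive1_powR. Qed.

Lemma derive_rule_eq f x df dg : is_derive x 1 f df -> df = dg -> is_derive x 1 f dg.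
Proof. by move=> + <-. Qed.

Lemma is_derive_continuous f x df : is_derive x 1 f df -> {for x, continuous f}.
Proof. by move=> [+ _] => /derivable1_diffP/differentiable_continuous. Qed.

Lemma is_derive_derive1 f x df : is_derive x 1 f df -> derive1 f x = df.
Proof. by move=> d; rewrite derive1E derive_val. Qed.

End calculus_rules.

(* Leaves the side conditions of [derive_ruleV] and [derive_rule_powR] as goals;
   [notypeclasses] keeps the [is_derive] instances from being searched for. *)
Ltac derive_step :=
  lazymatch goal with
  | |- is_derive _ _ (fun _ => ?c) _ => notypeclasses refine (derive_rule_cst _ _)
  | |- is_derive _ _ (fun y => y) _ => notypeclasses refine (derive_rule_id _)
  | |- is_derive _ _ (fun y => @GRing.opp _ _) _ => notypeclasses refine (derive_ruleN _)
  | |- is_derive _ _ (fun y => @expR _ _) _ => notypeclasses refine (derive_rule_expR _)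
  | |- is_derive _ _ (fun y => @GRing.inv _ _) _ => notypeclasses refine (derive_ruleV _ _)
  | |- is_derive _ _ (fun y => @powR _ _ _) _ => notypeclasses refine (derive_rule_powR _ _ _)
  | |- is_derive _ _ (fun y => @GRing.exp _ _ _) _ => notypeclasses refine (derive_ruleX _ _)
  | |- is_derive _ _ (fun y => @GRing.add _ _ _) _ => notypeclasses refine (derive_ruleD _ _)
  | |- is_derive _ _ (fun y => @GRing.mul _ _ _) _ => notypeclasses refine (derive_ruleM _ _)
  | |- is_derive _ _ (@GRing.add _ _) _ =>
    notypeclasses refine (derive_ruleD (derive_rule_cst _ _) (derive_rule_id _))
  | |- is_derive _ _ (@GRing.mul _ _) _ =>
    notypeclasses refine (derive_ruleM (derive_rule_cst _ _) (derive_rule_id _))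
  | |- is_derive _ _ (@GRing.inv _) _ =>
    notypeclasses refine (derive_ruleV (f := fun y => y) _ (derive_rule_id _))
  | |- is_derive _ _ (@GRing.opp _) _ => notypeclasses refine (derive_ruleN (derive_rule_id _))
  | |- is_derive _ _ ?f _ => first [eassumption | unfold f]
  | |- is_true (0 < _) => assumption
  | |- is_true (_ != _) => assumption
  end.

Ltac derive_eq := notypeclasses refine (derive_rule_eq _ _); [repeat derive_step|cbv beta].

Section continuity_rules.
Context {R : realType} {T : topologicalType}.
Implicit Types (f g : T -> R) (p : T) (c : R).

Lemma continuous_ruleD f g p : {for p, continuous f} -> {for p, continuous g} ->
  {for p, continuous (fun q => f q + g q)}.
Proof. exact: cvgD. Qed.

Lemma continuous_ruleN f p : {for p, continuous f} -> {for p, continuous (fun q => - f q)}.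
Proof. exact: cvgN. Qed.

Lemma continuous_ruleM f g p : {for p, continuous f} -> {for p, continuous g} ->
  {for p, continuous (fun q => f q * g q)}.
Proof. exact: cvgM. Qed.

Lemma continuous_ruleV f p : f p != 0 -> {for p, continuous f} ->
  {for p, continuous (fun q => (f q)^-1)}.
Proof. exact: cvgV. Qed.

Lemma continuous_rule_comp (h : R -> R) f p : {for f p, continuous h} ->
  {for p, continuous f} -> {for p, continuous (fun q => h (f q))}.
Proof. by move=> ? ?; apply: (@continuous_comp _ _ _ f h). Qed.

End continuity_rules.

(** * The Gamma integral *)

Section gamma_integral.
Context {R : realType}.
Notation mu := (@lebesgue_measure R).

(** The fundamental theorem and the substitution rule are applied on closed rays, away from a
    singularity at [0]; this limit brings them to the open half-line. The factor [c] lets the cut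
    points follow a dilation of the variable. *)
Lemma cvg_integral_truncl (G : R -> R) (c : R) : 0 < c ->
  (forall x, 0 < x -> {for x, continuous G}) -> (forall x, 0 < x -> 0 <= G x) ->
  (\int[mu]_(x in `[(c * n.+1%:R^-1)%R, +oo[) (G x)%:E @[n --> \oo]
    --> \int[mu]_(x in `]0%R, +oo[) (G x)%:E)%E.
Proof.
move=> c0 cG G0.
have e0 n : 0 < c * n.+1%:R^-1 by rewrite mulr_gt0// invr_gt0.
have mG : measurable_fun (`]0, +oo[ : set R) G.
  apply: open_continuous_measurable_fun => // x; rewrite inE/= in_itv/= andbT; exact: cG.
have -> : (`]0%R, +oo[ : set R) = \bigcup_n `[c * n.+1%:R^-1, +oo[.
  apply/seteqP; split=> [x|x [n _]] /=; rewrite !in_itv/= !andbT.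
    move=> x0; have := ltr_add_invr x0.
    exists (Num.truncn (c / x)) => //=; rewrite in_itv/= andbT.
    rewrite ler_pdivrMr// mulrC -ler_pdivrMr//.
    by apply/ltW; rewrite truncnS_gt.
  by move=> /lt_le_trans; apply.
apply: ge0_nondecreasing_set_cvg_integral => //.
- move=> m n mn; apply/subsetPset => x /=; rewrite !in_itv/= !andbT.
  apply: le_trans; rewrite ler_pM2l// lef_pV2 ?posrE// ler_nat; exact: mn.
- move=> n; apply/measurable_EFinP; apply: measurable_funS mG => // x /=.
  by rewrite !in_itv/= !andbT; exact: lt_le_trans.
- move=> n x /=; rewrite in_itv/= andbT => nx.
  by rewrite lee_fin G0// (lt_le_trans _ nx).
Qed.

Lemma integral_scale (G : R -> R) (c : R) : 0 < c ->
  (forall x, 0 < x -> {for x, continuous G}) -> (forall x, 0 < x -> 0 <= G x) ->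
  (\int[mu]_(x in `]0%R, +oo[) (G x)%:E =
   \int[mu]_(x in `]0%R, +oo[) (G (c * x) * c)%:E)%E.
Proof.
move=> c0 cG G0.
have cF : forall x, 0 < x -> {for x, continuous (fun x => G (c * x) * c)}.
  move=> x x0.
  apply: continuousM; last exact: cst_continuous.
  apply: continuous_comp; last by apply: cG; rewrite mulr_gt0.
  exact: mulrl_continuous.
have F0 x : 0 < x -> 0 <= G (c * x) * c.
  by move=> x0; rewrite mulr_ge0 ?G0 ?mulr_gt0// ltW.
have A := cvg_integral_truncl c0 cG G0.
have B := cvg_integral_truncl ltr01 cF F0.
rewrite -(cvg_lim _ A)// -(cvg_lim _ B)//; congr (lim (_ @ \oo)).
apply/funext => n; rewrite mul1r.
have e0 : 0 < n.+1%:R^-1 :> R by rewrite invr_gt0.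
have dF (x : R) : is_derive x 1 ( *%R c) c.
  by derive_eq; rewrite ?mulr0 ?addr0 ?mulr1.
have dFE : ( *%R c)^`() = cst c.
  by apply/funext => x; rewrite derive1E derive_val.
rewrite (@increasing_ge0_integration_by_substitutiony _ ( *%R c) G)//.
- by apply: eq_integral => x _; rewrite dFE.
- by move=> x y _ _ xy; rewrite ltr_pM2l.
- by rewrite dFE => x _; exact: cst_continuous.
- by rewrite dFE; exact: is_cvg_cst.
- by rewrite dFE; exact: is_cvg_cst.
- split=> //.
  apply: cvg_at_right_filter; apply/differentiable_continuous.
  by rewrite -derivable1_diffP; apply: ex_derive.
- exact: gt0_cvgMry.
- apply: continuous_in_subspaceT => x; rewrite inE/= in_itv/= andbT => nx.
  by apply: cG; rewrite (lt_le_trans _ nx)// mulr_gt0.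
- move=> x; rewrite in_itv/= andbT => nx; apply: G0.
  by rewrite (lt_trans _ nx)// mulr_gt0.
Qed.

Lemma continuous_powR_expR (a l x : R) : 0 < x ->
  {for x, continuous (fun y => y `^ a * expR (- (y * l)))}.
Proof.
by move=> x0; apply: is_derive_continuous; repeat derive_step.
Qed.

(** The majorant is, up to a factor, the derivative of -1/(1 + x^a), so its integral is explicit and
    small and large [x] need no separate treatment. *)
Lemma Gamma_bound (a : R) : 0 < a -> exists2 K : R, 0 < K &
  forall x, 0 < x ->
  x `^ (a - 1) * expR (- x) <= K * (x `^ (a - 1) * ((1 + x `^ a) ^+ 2)^-1).
Proof.
move=> a0; pose n := Num.truncn a.
have an : a <= n.+1%:R by apply/ltW; rewrite truncnS_gt.
(* From 1 + x^a <= 2 (1 + x)^(n+1), squared, and y^m <= m! exp(y) with y = 1 + x and m = 2 (n +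
   1). *)
exists (4 * (n.+1 * 2)`!%:R * expR 1).
  by rewrite !mulr_gt0 ?expR_gt0// ltr0n fact_gt0.
move=> x x0; rewrite mulrCA ler_wpM2l ?powR_ge0// expRN.
have xa0 : 0 < 1 + x `^ a by rewrite addr_gt0 ?powR_gt0.
rewrite ler_pdivlMr ?exprn_gt0// mulrC ler_pdivrMr ?expR_gt0//.
have x1 : 1 <= 1 + x by rewrite lerDl ltW.
have xan : x `^ a <= (1 + x) ^+ n.+1.
  rewrite (@le_trans _ _ ((1 + x) `^ a))//.
    by rewrite ge0_ler_powR ?nnegrE ?lerDr// ?(le_trans ler01 x1)// ltW.
  rewrite -powR_mulrn; last by rewrite (le_trans ler01 x1).
  exact: ler_powR.
have x1n : 1 <= (1 + x) ^+ n.+1 by rewrite exprn_ege1.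
rewrite (@le_trans _ _ ((2 * (1 + x) ^+ n.+1) ^+ 2))//.
  rewrite lerXn2r ?nnegrE ?(ltW xa0)//; first by rewrite (le_trans (ltW xa0))//; lra.
  lra.
rewrite exprMn -exprM (_ : 2 ^+ 2 = 4 :> R); last by ring.
rewrite -!mulrA ler_pM2l// -expRD -ler_pdivrMl; last by rewrite ltr0n fact_gt0.
rewrite mulrC.
have := @expR_ge1Dxn R (1 + x) (n.+1 * 2).-1 (le_trans ler01 x1).
rewrite prednK ?muln_gt0//; apply: le_trans.
by rewrite lerDr.
Qed.

Lemma integral_Gamma_fin (a : R) : 0 < a ->
  (\int[mu]_(x in `]0%R, +oo[) (x `^ (a - 1) * expR (- x))%:E < +oo)%E.
Proof.
move=> a0; have [K K0 HK] := Gamma_bound a0.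
pose g x := x `^ (a - 1) * expR (- x).
pose f x := K * (x `^ (a - 1) * ((1 + x `^ a) ^+ 2)^-1).
have xa0 x : 0 < 1 + x `^ a by rewrite ltr_pwDl ?powR_ge0.
have cg x : 0 < x -> {for x, continuous g}.
  move=> x0; have := @continuous_powR_expR (a - 1) 1 x x0.
  by under [X in {for x, continuous X}]eq_fun do rewrite mulr1.
have g0 x : 0 < x -> 0 <= g x by move=> _; rewrite mulr_ge0 ?powR_ge0 ?expR_ge0.
have C := cvg_integral_truncl ltr01 cg g0.
(* The primitive -(K/a)/(1 + x^a) of the majorant vanishes at infinity and stays above -K/a, so
   [K / a] bounds the integral over every ray. *)
rewrite (@le_lt_trans _ _ (K / a)%:E) ?ltry//.
rewrite -(cvg_lim _ C)//; apply: lime_le; first by apply/cvg_ex; eexists; exact: C.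
apply: nearW => n.
have e0 : 0 < 1 * n.+1%:R^-1 :> R by rewrite mul1r invr_gt0.
move: (1 * n.+1%:R^-1) e0 => e e0.
have df (x : R) : 0 < x ->
  is_derive x 1 (fun y => - (K / a) * (1 + y `^ a)^-1) (f x).
  move=> x0; derive_eq; first exact: lt0r_neq0 (xa0 x).
  by rewrite /f; field; rewrite !gt_eqF.
rewrite (@le_trans _ _ (\int[mu]_(x in `[e, +oo[) (f x)%:E)%E)//.
  apply: ge0_le_integral => //=.
  - by move=> x; rewrite in_itv/= andbT => ex; rewrite lee_fin g0// (lt_le_trans e0).
  - apply/measurable_EFinP; apply: subspace_continuous_measurable_fun => //.
    apply: continuous_in_subspaceT => x; rewrite inE/= in_itv/= andbT => ex.
    by apply: cg; exact: lt_le_trans ex.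
  - apply/measurable_EFinP; apply: subspace_continuous_measurable_fun => //.
    apply: continuous_in_subspaceT => x; rewrite inE/= in_itv/= andbT => ex.
    have x0 := lt_le_trans e0 ex.
    by apply: is_derive_continuous; repeat derive_step; rewrite gt_eqF ?exprn_gt0.
  - by move=> x; rewrite in_itv/= andbT => ex; rewrite lee_fin HK// (lt_le_trans e0).
pose F x := - (K / a) * (1 + x `^ a)^-1.
have cf x : e <= x -> {for x, continuous f}.
  move=> ex; have x0 := lt_le_trans e0 ex.
  by apply: is_derive_continuous; repeat derive_step; rewrite gt_eqF ?exprn_gt0.
rewrite (@ge0_continuous_FTC2y _ f F e 0).
- rewrite sub0e -EFinN lee_fin /F mulNr opprK ler_piMr ?divr_ge0 ?ltW//.
  by rewrite invf_lt1// ltrDl powR_gt0.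
- move=> x ex; rewrite mulr_ge0 ?mulr_ge0 ?powR_ge0 ?invr_ge0 ?exprn_ge0 ?(ltW K0)//.
  exact: ltW.
- apply: continuous_in_subspaceT => x; rewrite inE/= in_itv/= andbT; exact: cf.
- rewrite -(mulr0 (- (K / a))); apply: cvgM; first exact: cvg_cst.
  apply/gtr0_cvgV0; first by apply: nearW.
  apply/cvgryPge => A; near=> x.
  have x1 : Num.max 1 A `^ a^-1 <= x by near: x; apply: nbhs_pinfty_ge; exact: num_real.
  have : Num.max 1 A <= x `^ a.
    rewrite (@le_trans _ _ ((Num.max 1 A `^ a^-1) `^ a))//.
      by rewrite -powRrM mulVf ?gt_eqF// powRr1// le_max ler01.
    by rewrite ge0_ler_powR// ?nnegrE ?powR_ge0// ?(le_trans (powR_ge0 _ _) x1)// ltW.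
  by rewrite ge_max => /andP[_ /le_trans]; apply; rewrite lerDr.
- by move=> x ex; have [] := df x (lt_trans e0 ex).
- apply: cvg_at_right_filter; exact: is_derive_continuous (df _ e0).
- move=> x; rewrite in_itv/= andbT => ex.
  exact: is_derive_derive1 (df _ (lt_trans e0 ex)).
Unshelve. all: by end_near. Qed.

Lemma integral_Gamma (a : R) : 0 < a ->
  (\int[mu]_(x in `]0%R, +oo[) (x `^ (a - 1) * expR (- x))%:E = (Gamma a)%:E)%E.
Proof.
move=> a0; rewrite /Gamma /Rintegral fineK// ge0_fin_numE ?integral_Gamma_fin//.
by apply: integral_ge0 => x _; rewrite lee_fin mulr_ge0 ?powR_ge0 ?expR_ge0.
Qed.

Lemma Gamma_gt0 (a : R) : 0 < a -> 0 < Gamma a.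
Proof.
move=> a0; rewrite -lte_fin -integral_Gamma//.
pose g x := x `^ (a - 1) * expR (- x).
have cg x : 0 < x -> {for x, continuous g}.
  by move=> x0; apply: is_derive_continuous; repeat derive_step.
have mg : measurable_fun (`]0, +oo[ : set R) (EFin \o g).
  apply/measurable_EFinP; apply: open_continuous_measurable_fun => // x.
  by rewrite inE/= in_itv/= andbT; exact: cg.
have s12 : (`[1, 2] : set R) `<=` `]0, +oo[.
  by move=> x /=; rewrite !in_itv/= andbT => /andP[/(lt_le_trans ltr01)].
(* On [1, 2], x^(a-1) = x^a / x >= 1/2 whatever the sign of a - 1, and exp(-x) >= exp(-2). *)
rewrite (@lt_le_trans _ _ (\int[mu]_(x in `[1%R, 2%R]) (expR (- 2) / 2)%:E)%E)//.
  rewrite integral_cst//= lebesgue_measure_itv/= lte_fin ltr1n -EFinB -EFinM.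
  by rewrite lte_fin mulr_gt0 ?divr_gt0 ?expR_gt0//; lra.
rewrite (@le_trans _ _ (\int[mu]_(x in `[1%R, 2%R]) (g x)%:E)%E)//.
  apply: ge0_le_integral => //=.
  - exact: (measurable_funS (measurable_itv _) s12 mg).
  - move=> x; rewrite in_itv/= => /andP[x1 x2]; rewrite lee_fin /g mulrC.
    rewrite ler_pM ?invr_ge0 ?expR_ge0 ?ler_expR ?lerN2//.
    have x0 := lt_le_trans ltr01 x1.
    rewrite -(ler_pM2l x0) mulr_powRB1 ?(ltW x0)//.
    rewrite (@le_trans _ _ 1)//; first by rewrite ler_pdivrMr// mul1r.
    by have := @ge0_ler_powR R a (ltW a0) 1 x; rewrite powR1 !nnegrE; apply=> //; exact: ltW.
apply: ge0_subset_integral => //= x _.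
by rewrite lee_fin mulr_ge0 ?powR_ge0 ?expR_ge0.
Qed.

Lemma integral_Gamma_rate (a l : R) : 0 < a -> 0 < l ->
  (\int[mu]_(x in `]0%R, +oo[) (x `^ (a - 1) * expR (- (x * l)))%:E
   = (Gamma a / l `^ a)%:E)%E.
Proof.
move=> a0 l0.
have la0 : 0 < l `^ a by rewrite powR_gt0.
rewrite EFinM -integral_Gamma// muleC.
rewrite (@integral_scale (fun x => x `^ (a - 1) * expR (- x)) l)//; last 2 first.
- by move=> x x0; apply: is_derive_continuous; repeat derive_step.
- by move=> x _; rewrite mulr_ge0 ?powR_ge0 ?expR_ge0.
rewrite -ge0_integralZl//; last 3 first.
- apply/measurable_EFinP; apply: open_continuous_measurable_fun => // x.
  rewrite inE/= in_itv/= andbT => x0.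
  by apply: is_derive_continuous; repeat derive_step; rewrite mulr_gt0.
- by move=> x _; rewrite lee_fin !mulr_ge0 ?powR_ge0 ?expR_ge0// ltW.
- by rewrite lee_fin invr_ge0 ltW.
apply: eq_integral => x; rewrite inE/= in_itv/= andbT => x0.
rewrite -EFinM powRM ?(ltW x0) ?(ltW l0)// -[in l `^ a](mulr_powRB1 (ltW l0) a0).
congr EFin; rewrite [l * x]mulrC; field.
by rewrite !gt_eqF ?powR_gt0.
Qed.

End gamma_integral.

(** * Injectivity of the Laplace transform *)

Section laplace_injective.
Context {R : realType}.
Notation mu := (@lebesgue_measure R).
Notation Rpos := (`]0%R, +oo[ : set R).

Lemma measurable_pos_continuous (f : R -> R) :
  (forall x, 0 < x -> {for x, continuous f}) -> measurable_fun Rpos f.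
Proof.
move=> cf; apply: open_continuous_measurable_fun => // x.
by rewrite inE/= in_itv/= andbT; exact: cf.
Qed.

Lemma integrable_mul_bounded (A : set R) (f g : R -> R) (M : R) :
  measurable A -> mu.-integrable A (EFin \o f) -> measurable_fun A g ->
  (forall x, A x -> `|g x| <= M) ->
  mu.-integrable A (EFin \o (fun x => f x * g x)).
Proof.
move=> mA intf mg gM.
have mf : measurable_fun A f by apply/measurable_EFinP; exact: measurable_int intf.
apply: (@le_integrable _ _ _ mu A mA _ (fun x => (M * f x)%:E)).
- by apply/measurable_EFinP; exact: measurable_funM.
- move=> x Ax /=; rewrite lee_fin !normrM mulrC ler_wpM2r//.
  by rewrite (le_trans (gM x Ax))// ler_norm.
- by under eq_fun do rewrite EFinM; exact: integrableZl.
Qed.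

Lemma horner_bounded01 (p : {poly R}) :
  exists M : R, forall u, 0 <= u <= 1 -> `|p.[u]| <= M.
Proof.
elim/poly_ind: p => [|p c [M HM]]; first by exists 0 => u _; rewrite horner0 normr0.
exists (M + `|c|) => u u01; rewrite hornerMXaddC.
rewrite (le_trans (ler_normD _ _))// lerD2r normrM.
have /andP[u0 u1] := u01.
rewrite (le_trans _ (HM u u01))// (ger0_norm u0) ler_piMr//.
Qed.

Lemma expRN_01 (x : R) : 0 < x -> 0 <= expR (- x) <= 1.
Proof. by move=> x0; rewrite expR_ge0 expR_le1 oppr_le0 ltW. Qed.

Lemma continuous_horner_expRN (p : {poly R}) (x : R) :
  {for x, continuous (fun y => p.[expR (- y)])}.
Proof.
apply: continuous_rule_comp; first exact: continuous_horner.
by apply: is_derive_continuous; repeat derive_step.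
Qed.

(** Vanishing moments in the variable u = exp(-x) pass to polynomials by linearity. The extra power
    [n] loads the induction on [p]: the factor ['X] of [p * 'X + c%:P] is moved into it. *)
Lemma integral_horner_expRN (D : R -> R) :
  mu.-integrable Rpos (EFin \o D) ->
  (forall n, \int[mu]_(x in Rpos) (D x * expR (- x) ^+ n) = 0) ->
  forall (p : {poly R}) n,
    \int[mu]_(x in Rpos) (D x * (p.[expR (- x)] * expR (- x) ^+ n)) = 0.
Proof.
move=> intD D0.
have intp (p : {poly R}) :
    mu.-integrable Rpos (EFin \o (fun x => D x * p.[expR (- x)])).
  have [M HM] := horner_bounded01 p.
  apply: (@integrable_mul_bounded _ _ _ M) => //.
    by apply: measurable_pos_continuous => x _; exact: continuous_horner_expRN.
  by move=> x /=; rewrite in_itv/= andbT => x0; rewrite HM// expRN_01.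
elim/poly_ind => [|p c IH] n.
  under eq_Rintegral do rewrite horner0 mul0r mulr0.
  by rewrite Rintegral_cst// mul0r.
have E x : D x * ((p * 'X + c%:P).[expR (- x)] * expR (- x) ^+ n) =
    D x * (p * 'X^(n.+1)).[expR (- x)] + c * (D x * ('X^n).[expR (- x)]).
  by rewrite hornerMXaddC hornerM !hornerXn exprS; ring.
under eq_Rintegral do rewrite E.
rewrite RintegralD//; last first.
  have := intp (c *: 'X^n); congr (mu.-integrable _ (EFin \o _)).
  by apply/funext => x; rewrite hornerZ mulrCA.
rewrite RintegralZl//.
under eq_Rintegral do rewrite hornerM hornerXn.
under [X in _ + _ * X]eq_Rintegral do rewrite hornerXn.
by rewrite IH D0 mulr0 addr0.
Qed.

Lemma expRN_lipschitz (x y : R) : 0 < x -> 0 < y ->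
  `|expR (- x) - expR (- y)| <= `|x - y|.
Proof.
wlog xy : x y / x <= y => [H x0 y0|x0 y0].
  by have [xy|/ltW yx] := leP x y; [exact: H|rewrite distrC (distrC x); exact: H].
rewrite [leRHS]distrC !ger0_norm ?subr_ge0 ?ler_expR ?lerN2//.
have := expR_ge1Dx (- (y - x)); have /andP[e0 e1] := expRN_01 x0.
rewrite (_ : expR (- y) = expR (- x) * expR (- (y - x))); last first.
  by rewrite -expRD; congr expR; ring.
have : expR (- (y - x)) <= 1 by rewrite expR_le1; lra.
nra.
Qed.

(* The powers of the polynomial [1 + r^2 - (u - expR (- x))^2] in [u = expR (- y)]
   blow up near [y = x] and stay below [1] away from it. *)
Lemma laplace_le0 (D : R -> R) :
  mu.-integrable Rpos (EFin \o D) ->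
  (forall x, 0 < x -> {for x, continuous D}) ->
  (forall n, \int[mu]_(x in Rpos) (D x * expR (- x) ^+ n) = 0) ->
  forall x, 0 < x -> D x <= 0.
Proof.
move=> intD cD D0 x x0; rewrite leNgt; apply/negP => Dx.
have [d [d0 dx dD]] : exists d, [/\ 0 < d, d < x &
    forall y, `|x - y| <= d -> D x / 2 <= D y].
  have /cvgrPdist_lt/(_ (D x / 2)) := cD x x0.
  rewrite divr_gt0// => /(_ isT) /nbhs_ballP[e /= e0 He].
  exists (Num.min e x / 2); split.
  - by rewrite divr_gt0// lt_min e0.
  - by rewrite ltr_pdivrMr// gt_min mulr2n mulrDr mulr1 ltrDl x0 orbT.
  - move=> y xy; have /He : ball x e y.
      rewrite /ball/= (le_lt_trans xy)// ltr_pdivrMr//.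
      by rewrite (@le_lt_trans _ _ e) ?ge_min ?lexx// mulrDr mulr1 ltrDl.
    by move=> /(le_lt_trans (ler_norm _)); lra.
pose u := expR (- x).
(* The variable u = exp(-y) is monotone in y, so every point further than [d] from [x] is at least
   [r] away from exp(-x) in u. *)
pose r := Num.min (u - expR (- (x + d))) (expR (- (x - d)) - u).
have r0 : 0 < r by rewrite lt_min !subr_gt0 !ltr_expR; apply/andP; split; lra.
have out y : d < `|x - y| -> r <= `|expR (- y) - u|.
  rewrite ltr_normr => /orP[] h.
    rewrite (le_trans _ (ler_norm _))// ge_min; apply/orP; right.
    by rewrite lerD2r ler_expR; lra.
  rewrite distrC (le_trans _ (ler_norm _))// ge_min; apply/orP; left.
  by rewrite lerD2l lerN2 ler_expR; lra.
(* As exp(-y) is 1-Lipschitz, within [d'] of [x] the distance in u is at most r/2. There the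
   polynomial [Q] is at least 1 + r^2 - r^2/4, which exceeds the constant [k]. *)
pose d' := Num.min d (r / 2).
have d'0 : 0 < d' by rewrite lt_min d0/= divr_gt0.
have near_ y : 0 < y -> `|x - y| <= d' -> `|expR (- y) - u| <= r / 2.
  move=> y0 xy; rewrite (le_trans (expRN_lipschitz y0 x0))// distrC (le_trans xy)//.
  by rewrite ge_min lexx orbT.
pose Q : {poly R} := (1 + r ^+ 2)%:P - ('X - u%:P) ^+ 2.
have QE v : Q.[v] = 1 + r ^+ 2 - (v - u) ^+ 2 by rewrite /Q !hornerE.
pose k := 1 + r ^+ 2 / 2.
have J'pos : (`[x - d', x + d'] : set R) `<=` Rpos.
  move=> y /=; rewrite !in_itv/= andbT => /andP[h _]; apply: lt_le_trans h.
  by rewrite subr_gt0 (le_lt_trans _ dx)// ge_min lexx.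
(* Three zones: within [d'] of [x], [Q] is at least [k] and [D] at least [D x / 2]; up to distance
   [d], both are still nonnegative; further out |Q| <= 1, so the loss is at most |D y|. *)
have lb m y : 0 < y ->
    k ^+ m * (D x / 2) * \1_(`[x - d', x + d'] : set R) y - `|D y|
      <= D y * Q.[expR (- y)] ^+ m.
  move=> y0; rewrite QE.
  set v := expR (- y).
  have v01 : 0 <= v <= 1 by rewrite /v expRN_01.
  have u01 : 0 <= u <= 1 by rewrite /u expRN_01.
  have q0 : 0 <= 1 + r ^+ 2 - (v - u) ^+ 2.
    have : (v - u) ^+ 2 <= 1.
      rewrite -(real_normK (num_real (v - u))) exprn_ile1// ler_norml.
      by apply/andP; split; lra.
    by have := sqr_ge0 r; lra.
  have [h|h] := leP (`|x - y|) d.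
    have Dy : 0 < D y by rewrite (lt_le_trans _ (dD y h))// divr_gt0.
    rewrite indicE; case: (boolP (y \in _)) => [|_]; last first.
      by rewrite mulr0 sub0r (@le_trans _ _ 0)// ?oppr_le0// mulr_ge0 ?exprn_ge0// ltW.
    rewrite inE/= in_itv/= => /andP[hy1 hy2]; rewrite mulr1 lerBlDr.
    rewrite (@le_trans _ _ (D y * (1 + r ^+ 2 - (v - u) ^+ 2) ^+ m))//; last by rewrite lerDl.
    rewrite mulrC ler_pM ?exprn_ge0 ?dD ?divr_ge0 ?(ltW Dx)//.
      by rewrite addr_ge0// divr_ge0// sqr_ge0.
    have k0 : 0 <= k by rewrite addr_ge0// divr_ge0// sqr_ge0.
    rewrite lerXn2r ?nnegrE//.
    have vu : `|v - u| <= r / 2.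
      by apply: near_ => //; rewrite ler_norml; apply/andP; split; lra.
    have : (v - u) ^+ 2 <= (r / 2) ^+ 2.
      by rewrite -(real_normK (num_real (v - u))) lerXn2r ?nnegrE// divr_ge0// ltW.
    by rewrite expr_div_n /k => h1; have h2 := sqr_ge0 r; nra.
  rewrite indicE memNset ?mulr0 ?sub0r; last first.
    move=> /=; rewrite in_itv/= => /andP[hy1 hy2]; move: h; apply/negP; rewrite -leNgt.
    have : d' <= d by rewrite ge_min lexx.
    by move=> ?; rewrite ler_norml; apply/andP; split; lra.
  rewrite (@le_trans _ _ (- `|D y * (1 + r ^+ 2 - (v - u) ^+ 2) ^+ m|))//; last first.
    by rewrite lerNl -normrN ler_norm.
  rewrite lerN2 normrM ler_piMr// normrX exprn_ile1//.
  rewrite ger0_norm//.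
  have : r ^+ 2 <= (v - u) ^+ 2.
    by rewrite -(real_normK (num_real (v - u))) lerXn2r ?nnegrE ?(ltW r0)// out.
  lra.
have mJ : mu (`[x - d', x + d'] : set R) = (2 * d')%:E.
  rewrite lebesgue_measure_itv/= lte_fin ifT; last lra.
  by rewrite -EFinB; congr EFin; ring.
have intI : mu.-integrable Rpos (EFin \o (\1_(`[x - d', x + d'] : set R) : R -> R)).
  apply/integrableP; split; first by apply/measurable_EFinP; exact: measurable_indic.
  under eq_integral do rewrite /= ger0_norm//.
  by rewrite integral_indic// setIidl//; apply: (@le_lt_trans _ _ (2 * d')%:E);
    [rewrite -mJ; exact: lexx|exact: ltry].
have intabs : mu.-integrable Rpos (EFin \o (fun y => `|D y|)) by exact: integrable_norm.
have int1 : \int[mu]_(y in Rpos) \1_(`[x - d', x + d'] : set R) y = 2 * d'.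
  by rewrite /Rintegral integral_indic// setIidl//; transitivity (fine (2 * d')%:E) => //; rewrite -mJ.
have key m : k ^+ m * (D x / 2) * (2 * d') <= \int[mu]_(y in Rpos) `|D y|.
  have intK : mu.-integrable Rpos (EFin \o (fun y =>
      k ^+ m * (D x / 2) * \1_(`[x - d', x + d'] : set R) y)).
    exact: (@integrableZl _ _ _ mu _ _ (k ^+ m * (D x / 2)) _ intI).
  rewrite -int1 -RintegralZl// -subr_le0 -RintegralB//.
  have := @integral_horner_expRN D intD D0 (Q ^+ m) 0.
  under eq_Rintegral do rewrite expr0 mulr1 horner_exp.
  move=> E; rewrite -[leRHS]E; apply: le_Rintegral => //.
  - exact: (@integrableB _ _ _ mu _ _ _ _ intK intabs).
  - have [M HM] := horner_bounded01 (Q ^+ m).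
    apply: (@integrable_mul_bounded _ _ _ M) => //.
      apply: measurable_pos_continuous => y _; have := @continuous_horner_expRN (Q ^+ m) y.
      by under [X in {for _, continuous X}]eq_fun do rewrite horner_exp.
    by move=> y /=; rewrite in_itv/= andbT => y0; rewrite -horner_exp HM// expRN_01.
  - by move=> y /=; rewrite in_itv/= andbT; exact: lb.
(* Bernoulli's inequality: k^m grows at least linearly in [m], whereas the right side of [key] does
   not depend on [m]. *)
have bern m : 1 + m%:R * (r ^+ 2 / 2) <= k ^+ m.
  elim: m => [|m IH]; first by rewrite expr0 mul0r addr0.
  rewrite [k ^+ m.+1]exprS -natr1.
  have r2 : 0 <= r ^+ 2 / 2 by rewrite divr_ge0// sqr_ge0.
  have h1 := ler_wpM2l r2 IH.
  have h2 := mulr_ge0 (ler0n R m) (mulr_ge0 r2 r2).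
  have -> : k * k ^+ m = k ^+ m + r ^+ 2 / 2 * k ^+ m by rewrite {1}/k; ring.
  set K := k ^+ m in IH h1 *; set e := r ^+ 2 / 2 in r2 IH h1 h2 *.
  lra.
have c0 : 0 < r ^+ 2 / 2 * (D x / 2 * (2 * d')).
  by rewrite !mulr_gt0// ?exprn_gt0// ?invr_gt0.
pose I := \int[mu]_(y in Rpos) `|D y|.
have := key (Num.truncn (I / (r ^+ 2 / 2 * (D x / 2 * (2 * d'))))).+1.
have := truncnS_gt (I / (r ^+ 2 / 2 * (D x / 2 * (2 * d')))).
rewrite ltr_pdivrMr//.
set m := (Num.truncn _).+1 => h1 h2; have h3 := bern m.
have c1 : 0 < D x / 2 * (2 * d') by rewrite !mulr_gt0// ?invr_gt0.
have h4 : (1 + m%:R * (r ^+ 2 / 2)) * (D x / 2 * (2 * d')) <= I.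
  by rewrite (le_trans (ler_wpM2r (ltW c1) h3))// mulrA.
have := le_lt_trans h4 h1.
move: (m%:R : R) (r ^+ 2 / 2) (D x / 2 * (2 * d')) c1 => a e s s0.
by rewrite mulrDl mul1r mulrA ltNge lerDr ltW.
Qed.

Lemma laplace_injective (D : R -> R) :
  mu.-integrable Rpos (EFin \o D) ->
  (forall x, 0 < x -> {for x, continuous D}) ->
  (forall n, \int[mu]_(x in Rpos) (D x * expR (- x) ^+ n) = 0) ->
  forall x, 0 < x -> D x = 0.
Proof.
move=> intD cD D0 x x0; apply/eqP; rewrite eq_le laplace_le0//=.
rewrite -oppr_le0; apply: (@laplace_le0 (fun x => - D x)) => //.
- exact: (integrableN intD).
- by move=> y y0; apply: continuous_ruleN; exact: cD.
- move=> n; under eq_Rintegral do rewrite mulNr -mulN1r.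
  rewrite RintegralZl ?D0 ?mulr0//.
  apply: (@integrable_mul_bounded _ _ _ 1) => //.
    apply: measurable_pos_continuous => y _.
    by apply: is_derive_continuous; repeat derive_step.
  move=> y /=; rewrite in_itv/= andbT => /expRN_01/andP[h0 h1].
  by rewrite ger0_norm ?exprn_ge0 ?exprn_ile1.
Qed.

End laplace_injective.

(** * Integrals of functions continuous on a strip *)

Section quadrant.
Context {R : realType}.
Notation mu := (@lebesgue_measure R).

Lemma continuous_rule_cst (T : topologicalType) (c : R) (p : T) :
  {for p, continuous (fun=> c)}.
Proof. exact: cvg_cst. Qed.

Lemma continuous_rule_id (T : topologicalType) (p : T) : {for p, continuous (fun q => q)}.
Proof. exact: cvg_id. Qed.

Lemma continuous_rule_fst (p : R * R) : {for p, continuous (fun q : R * R => q.1)}.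
Proof. exact: cvg_fst. Qed.

Lemma continuous_rule_snd (p : R * R) : {for p, continuous (fun q : R * R => q.2)}.
Proof. exact: cvg_snd. Qed.

Lemma continuous_rule_comp_fst (g : R -> R) (p : R * R) :
  {for p.1, continuous g} -> {for p, continuous (fun q : R * R => g q.1)}.
Proof. by move=> cg; apply: (continuous_rule_comp cg); exact: cvg_fst. Qed.

Lemma continuous_rule_comp_snd (g : R -> R) (p : R * R) :
  {for p.2, continuous g} -> {for p, continuous (fun q : R * R => g q.2)}.
Proof. by move=> cg; apply: (continuous_rule_comp cg); exact: cvg_snd. Qed.

Lemma continuous_rule_expR (T : topologicalType) (f : T -> R) (p : T) :
  {for p, continuous f} -> {for p, continuous (fun q => expR (f q))}.
Proof. by move=> cf; apply: continuous_rule_comp cf; exact: continuous_expR. Qed.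

Lemma continuous_ruleX (T : topologicalType) (f : T -> R) (p : T) n :
  {for p, continuous f} -> {for p, continuous (fun q => f q ^+ n)}.
Proof.
move=> cf; elim: n => [|n IH]; first exact: continuous_rule_cst.
rewrite (_ : (fun q => f q ^+ n.+1) = (fun q => f q * f q ^+ n)).
  exact: continuous_ruleM.
by apply/funext => q; rewrite exprS.
Qed.

(** Time is bounded by [v] because the coefficients of the test function are used only up to
    slightly past the terminal time, as long as their denominator stays positive. *)
Definition continuous_on_strip (v : R) (F : R -> R -> R) :=
  forall x t, 0 < x -> 0 < t < v -> {for (x, t), continuous (fun p => F p.1 p.2)}.

Lemma strip_continuous_fst v F x t : continuous_on_strip v F ->
  0 < x -> 0 < t < v -> {for x, continuous (F ^~ t)}.
Proof.
move=> cF x0 tv A /(cF x t x0 tv)[[P Q] /= [HP HQ] sub].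
apply: filterS HP => y Py; apply: (sub (y, t)); split => //=.
exact: nbhs_singleton HQ.
Qed.

Lemma strip_continuous_snd v F x t : continuous_on_strip v F ->
  0 < x -> 0 < t < v -> {for t, continuous (F x)}.
Proof.
move=> cF x0 tv A /(cF x t x0 tv)[[P Q] /= [HP HQ] sub].
apply: filterS HQ => s Qs; apply: (sub (x, s)); split => //=.
exact: nbhs_singleton HP.
Qed.

Lemma strip_bounded v F c d u w : continuous_on_strip v F ->
  0 < c -> 0 < u -> w < v -> exists2 M : R, 0 <= M &
  forall x t, c <= x <= d -> u <= t <= w -> `|F x t| <= M.
Proof.
move=> cF c0 u0 wv.
have cK : compact (`[c, d] `*` `[u, w] : set (R * R)).
  by apply: compact_setX; exact: segment_compact.
have : compact ((fun p : R * R => F p.1 p.2) @` (`[c, d] `*` `[u, w])).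
  apply: continuous_compact => //; apply: continuous_in_subspaceT => -[x t].
  rewrite inE/= !in_itv/= => -[/andP[cx _] /andP[ut tw]].
  by apply: cF; [exact: lt_le_trans cx|rewrite (lt_le_trans u0 ut) (le_lt_trans tw wv)].
move=> /compact_bounded[M [_ HM]].
exists (Num.max 0 (M + 1)) => [|x t cx ut]; first by rewrite le_max lexx.
rewrite le_max; apply/orP; right; apply: (HM (M + 1)); first by rewrite ltrDl.
by exists (x, t) => //=; rewrite !in_itv.
Qed.

Lemma integrable_segment (f : R -> R) (c d : R) : 0 < c ->
  (forall x, 0 < x -> {for x, continuous f}) ->
  mu.-integrable `[c, d] (EFin \o f).
Proof.
move=> c0 cf; apply: continuous_compact_integrable; first exact: segment_compact.
apply: continuous_in_subspaceT => x; rewrite inE/= in_itv/= => /andP[cx _].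
by apply: cf; exact: lt_le_trans cx.
Qed.

Lemma Rintegral_derive (f F : R -> R) (c d : R) : 0 < c -> c < d ->
  (forall x, 0 < x -> x <= d -> is_derive x 1 F (f x)) ->
  (forall x, 0 < x -> x <= d -> {for x, continuous f}) ->
  \int[mu]_(x in `[c, d]) f x = F d - F c.
Proof.
move=> c0 cd dF cf.
rewrite /Rintegral (@continuous_FTC2 _ f F)//.
- apply: continuous_in_subspaceT => x; rewrite inE/= in_itv/= => /andP[cx xd].
  by apply: cf => //; exact: lt_le_trans cx.
- split.
  + move=> x; rewrite in_itv/= => /andP[cx xd].
    by have [] := dF x (lt_trans c0 cx) (ltW xd).
  + by apply: cvg_at_right_filter; exact: is_derive_continuous (dF c c0 (ltW cd)).
  + by apply: cvg_at_left_filter; exact: is_derive_continuous (dF d (lt_trans c0 cd) (lexx d)).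
- move=> x; rewrite in_itv/= => /andP[cx xd].
  exact: is_derive_derive1 (dF x (lt_trans c0 cx) (ltW xd)).
Qed.

(** Endpoints of a time window around [t] whose closure stays in the strip: [strip_bounded] on this
    window yields the constant that dominates under the integral sign. *)
Let strip_mid (t v : R) : 0 < t < v ->
  [/\ 0 < t / 2, t / 2 < t, t < (t + v) / 2 & (t + v) / 2 < v].
Proof. by move=> /andP[t0 tv]; split; lra. Qed.

Lemma strip_integral_continuous v F c d t : continuous_on_strip v F -> 0 < c ->
  0 < t < v -> {for t, continuous (fun s => \int[mu]_(x in `[c, d]) F x s)}.
Proof.
move=> cF c0 tv; have [u0 ut tw wv] := strip_mid tv.
have [M M0 HM] := @strip_bounded v F c d _ _ cF c0 u0 wv.
apply: (@continuity_under_integral _ _ _ mu (fun s x => F x s) `[c, d] _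
  (t / 2) ((t + v) / 2) _ _ (fun=> M)) => //.
- move=> s /=; rewrite in_itv/= => /andP[us sw].
  apply: integrable_segment => // x x0; apply: strip_continuous_fst cF _ _ => //.
  by rewrite (lt_trans u0 us) (lt_trans sw wv).
- apply: aeW => x /=; rewrite in_itv/= => /andP[cx _] s; rewrite inE/= in_itv/= => /andP[us sw].
  apply: strip_continuous_snd cF _ _; first exact: lt_le_trans cx.
  by rewrite (lt_trans u0 us) (lt_trans sw wv).
- apply: integrable_segment => // x _; exact: continuous_rule_cst.
- move=> s /=; rewrite in_itv/= => /andP[us sw]; apply: aeW => x /=; rewrite in_itv/= => cx.
  by apply: HM => //; rewrite !ltW.
- by rewrite inE/= in_itv/= ut.
Qed.

Lemma strip_integral_derive v F Ft c d t :
  continuous_on_strip v F -> continuous_on_strip v Ft -> 0 < c ->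
  (forall x s, 0 < x -> 0 < s < v -> is_derive s 1 (F x) (Ft x s)) ->
  0 < t < v -> is_derive t 1 (fun s => \int[mu]_(x in `[c, d]) F x s)
    (\int[mu]_(x in `[c, d]) Ft x t).
Proof.
move=> cF cFt c0 dF tv; have [u0 ut tw wv] := strip_mid tv.
have [M M0 HM] := @strip_bounded v Ft c d _ _ cFt c0 u0 wv.
have sv s : (`](t / 2), ((t + v) / 2)[ : set R) s -> 0 < s < v.
  by rewrite /= in_itv/= => /andP[us sw]; rewrite (lt_trans u0 us) (lt_trans sw wv).
have c0x x : (`[c, d] : set R) x -> 0 < x.
  by rewrite /= in_itv/= => /andP[cx _]; exact: lt_le_trans cx.
have tI : (`](t / 2), ((t + v) / 2)[ : set R) t by rewrite /= in_itv/= ut.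
have intF s : (`](t / 2), ((t + v) / 2)[ : set R) s ->
    mu.-integrable `[c, d] (EFin \o (fun x => F x s)).
  by move=> sI; apply: integrable_segment => // x x0; apply: strip_continuous_fst cF _ _; rewrite ?sv.
have derF s x : (`](t / 2), ((t + v) / 2)[ : set R) s -> (`[c, d] : set R) x ->
    derivable (F x) s 1.
  by move=> sI xI; have [] := dF x s (c0x _ xI) (sv _ sI).
have intM : mu.-integrable `[c, d] (EFin \o (fun=> M)).
  by apply: integrable_segment => // x _; exact: continuous_rule_cst.
have ub s x : (`](t / 2), ((t + v) / 2)[ : set R) s -> (`[c, d] : set R) x ->
    `|partial1of2 (fun s x => F x s) s x| <= M.
  move=> sI xI; rewrite /partial1of2 (is_derive_derive1 (dF x s (c0x _ xI) (sv _ sI))).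
  move: sI xI; rewrite /= !in_itv/= => /andP[us sw] xI.
  by apply: HM => //; rewrite !ltW.
split.
  exact: (@derivable_under_integral _ _ _ mu (fun s x => F x s) `[c, d] _ t _ _ tI
    intF derF (fun=> M) (fun=> M0) intM ub).
rewrite -derive1E (@differentiation_under_integral _ _ _ mu (fun s x => F x s) `[c, d] _ t _ _ tI
    intF derF (fun=> M) (fun=> M0) intM ub)//.
apply: eq_Rintegral => x; rewrite inE => xI.
by rewrite /partial1of2 (is_derive_derive1 (dF x t (c0x _ xI) tv)).
Qed.

End quadrant.

Ltac continuous_step :=
  lazymatch goal with
  | |- {for _, continuous (fun _ => ?c)} => apply: continuous_rule_cst
  | |- {for _, continuous (fun q => q)} => exact: continuous_rule_id
  | |- {for _, continuous (fun q => @fst _ _ q)} => apply: continuous_rule_fst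
  | |- {for _, continuous (fun q => @snd _ _ q)} => apply: continuous_rule_snd
  | |- {for _, continuous (fun q => @GRing.opp _ _)} => apply: continuous_ruleN
  | |- {for _, continuous (fun q => @expR _ _)} => apply: continuous_rule_expR
  | |- {for _, continuous (fun q => @GRing.inv _ _)} => apply: continuous_ruleV
  | |- {for _, continuous (fun q => @GRing.exp _ _ _)} => apply: continuous_ruleX
  | |- {for _, continuous (fun q => @GRing.add _ _ _)} => apply: continuous_ruleD
  | |- {for _, continuous (fun q => @GRing.mul _ _ _)} => apply: continuous_ruleM
  | |- {for _, continuous _} => first
      [eassumption | exact: mulrl_continuous | exact: continuous_rule_fst | exact: continuous_rule_snd]
  end.

(** * Weak form of the Fokker-Planck equation *)

Section conservation.
Context {R : realType}.
Notation leb := (@lebesgue_measure R).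
Notation Rpos := (`]0%R, +oo[ : set R).
Variables (beta gamma mu : R) (h ht hx hxx : R -> R -> R).
Hypotheses (gamma_gt0 : 0 < gamma) (mu_gt0 : 0 < mu).
Hypothesis h_dt : forall x t : R, 0 < x -> 0 < t -> is_derive t 1 (h x) (ht x t).
Hypothesis h_dx : forall x t : R, 0 < x -> 0 < t -> is_derive x 1 (h ^~ t) (hx x t).
Hypothesis h_dxx : forall x t : R, 0 < x -> 0 < t -> is_derive x 1 (hx ^~ t) (hxx x t).
Hypothesis h_cont : forall v, continuous_on_strip v h.
Hypothesis ht_cont : forall v, continuous_on_strip v ht.
Hypothesis h_pde : forall x t : R, 0 < x -> 0 < t ->
  ht x t = - (beta * h x t + (beta * x + gamma * mu) * hx x t)
           + 2 * mu * hx x t + mu * x * hxx x t.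

(** Green's identity: the integrand is the derivative of W = -k J - mu x k' h, with J the
    probability flux. The zeros of [k] and [kx] at both ends make [W] vanish there, so no boundary
    value of [h] enters. *)
Lemma weak_form_eq0 (c d t : R) (k kx kxx : R -> R) : 0 < t -> 0 < c -> c < d ->
  (forall x : R, 0 < x -> is_derive x 1 k (kx x)) ->
  (forall x : R, 0 < x -> is_derive x 1 kx (kxx x)) ->
  (forall x : R, 0 < x -> {for x, continuous kxx}) ->
  k c = 0 -> k d = 0 -> kx c = 0 -> kx d = 0 ->
  \int[leb]_(x in `[c, d]) (k x * ht x t
    - ((beta * x + gamma * mu) * kx x + mu * x * kxx x) * h x t) = 0.
Proof.
move=> t0 c0 cd dk dkx ck kc kd kxc kxd.
pose W x := - (k x * ((beta * x + gamma * mu) * h x t - mu * h x t - mu * x * hx x t))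
            - mu * x * kx x * h x t.
have tv : 0 < t < t + 1 by rewrite t0 ltrDl ltr01.
transitivity (W d - W c); last first.
  by rewrite /W kc kd kxc kxd; ring.
apply: Rintegral_derive => //.
- move=> x x0 _; have d1 := dk x x0; have d2 := dkx x x0.
  have d3 := h_dx x0 t0; have d4 := h_dxx x0 t0.
  derive_eq.
  by rewrite h_pde//; ring.
- move=> x x0 _.
  have c1 := is_derive_continuous (dk x x0).
  have c2 := is_derive_continuous (dkx x x0).
  have c3 := ck x x0.
  have c4 := strip_continuous_fst (@h_cont (t + 1)) x0 tv.
  have c5 := strip_continuous_fst (@ht_cont (t + 1)) x0 tv.
  by repeat continuous_step.
Qed.

(** The conclusion carries along the continuity in time of the inner integral, because the later
    passage to the limit under the time integral needs its measurability. *)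
Lemma weak_form (v c d : R) (k kt kx kxx : R -> R -> R) (t1 t2 : R) :
  0 < c -> c < d -> 0 < t1 -> t1 < t2 -> t2 < v ->
  continuous_on_strip v k -> continuous_on_strip v kt ->
  continuous_on_strip v kx -> continuous_on_strip v kxx ->
  (forall x t : R, 0 < x -> 0 < t < v -> is_derive t 1 (k x) (kt x t)) ->
  (forall x t : R, 0 < x -> 0 < t < v -> is_derive x 1 (k ^~ t) (kx x t)) ->
  (forall x t : R, 0 < x -> 0 < t < v -> is_derive x 1 (kx ^~ t) (kxx x t)) ->
  (forall t : R, 0 < t < v -> [/\ k c t = 0, k d t = 0, kx c t = 0 & kx d t = 0]) ->
  (forall t, 0 < t < v -> {for t, continuous (fun t => \int[leb]_(x in `[c, d])
     ((kt x t + (beta * x + gamma * mu) * kx x t + mu * x * kxx x t) * h x t))}) /\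
  \int[leb]_(x in `[c, d]) (k x t2 * h x t2) - \int[leb]_(x in `[c, d]) (k x t1 * h x t1) =
  \int[leb]_(t in `[t1, t2]) \int[leb]_(x in `[c, d])
     ((kt x t + (beta * x + gamma * mu) * kx x t + mu * x * kxx x t) * h x t).
Proof.
move=> c0 cd t10 t12 t2v ck ckt ckx ckxx dkt dkx dkxx bc.
pose G x t := (kt x t + (beta * x + gamma * mu) * kx x t + mu * x * kxx x t) * h x t.
have cG : continuous_on_strip v G.
  move=> x t x0 tv.
  have c1 := ckt x t x0 tv; have c2 := ckx x t x0 tv; have c3 := ckxx x t x0 tv.
  have c4 := h_cont x0 tv.
  by rewrite /G; repeat continuous_step.
have cF : continuous_on_strip v (fun x t => k x t * h x t).
  move=> x t x0 tv; have c1 := ck x t x0 tv; have c4 := h_cont x0 tv.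
  by repeat continuous_step.
have cFt : continuous_on_strip v (fun x t => k x t * ht x t + h x t * kt x t).
  move=> x t x0 tv; have c1 := ck x t x0 tv; have c4 := h_cont x0 tv.
  have c2 := ckt x t x0 tv; have c3 := ht_cont x0 tv.
  by repeat continuous_step.
have st s : 0 < s -> s <= t2 -> 0 < s < v.
  by move=> -> /le_lt_trans; apply.
split=> [t tv|]; first exact: strip_integral_continuous cG c0 tv.
symmetry; apply: (@Rintegral_derive _ (fun s => \int[leb]_(x in `[c, d]) G x s)
  (fun s => \int[leb]_(x in `[c, d]) (k x s * h x s))) => //; last first.
  by move=> s s0 st2; apply: strip_integral_continuous cG c0 (st s s0 st2).
move=> s s0 st2; have sv := st s s0 st2.
have -> : \int[leb]_(x in `[c, d]) G x s =
    \int[leb]_(x in `[c, d]) (k x s * ht x s + h x s * kt x s).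
  (* Adding this null integral trades the generator acting on [k] for the time derivative of [h];
     what remains is the time derivative of the product of [k] and [h]. *)
  pose Z x := k x s * ht x s
    - ((beta * x + gamma * mu) * kx x s + mu * x * kxx x s) * h x s.
  have [b1 b2 b3 b4] := bc s sv.
  have Z0 : \int[leb]_(x in `[c, d]) Z x = 0.
    apply: weak_form_eq0 => // [x x0|x x0|x x0]; first exact: dkx.
    - exact: dkxx.
    - exact: strip_continuous_fst ckxx x0 sv.
  rewrite -[LHS]addr0 -Z0 -RintegralD//.
  - by apply: eq_Rintegral => x _; rewrite /G /Z; ring.
  - by apply: integrable_segment => // x x0; exact: strip_continuous_fst cG x0 sv.
  - apply: integrable_segment => // x x0; rewrite /Z.
    have e1 := strip_continuous_fst ck x0 sv.
    have e2 := strip_continuous_fst ckx x0 sv.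
    have e3 := strip_continuous_fst ckxx x0 sv.
    have e4 := strip_continuous_fst (@h_cont v) x0 sv.
    have e5 := strip_continuous_fst (@ht_cont v) x0 sv.
    by repeat continuous_step.
apply: (@strip_integral_derive _ v _ (fun x t => k x t * ht x t + h x t * kt x t)) => //.
move=> x r x0 rv; have /andP[r0 _] := rv.
by apply: derive_ruleM; [exact: dkt|exact: h_dt].
Qed.

End conservation.

(** * Limits of truncated integrals *)

Section truncation.
Context {R : realType}.
Notation leb := (@lebesgue_measure R).
Notation Rpos := (`]0%R, +oo[ : set R).

(** Dominated convergence with majorant C |f|. Integrand and interval depend on the same parameter,
    and the bound is asked on the interval only: outside it the cut-off introduced below is
    unbounded. *)
Lemma cvg_Rintegral_trunc (f : R -> R) (H : R -> R -> R) (H0 : R -> R) (C : R)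
    (e : nat -> R) : 0 <= C ->
  leb.-integrable Rpos (EFin \o f) ->
  (forall n, 0 < e n) -> e n @[n --> \oo] --> 0 ->
  (forall n (x : R), 0 < x -> {for x, continuous (H (e n))}) ->
  (forall n x, e n <= x <= (e n)^-1 -> `|H (e n) x| <= C) ->
  (forall x : R, 0 < x -> {for 0, continuous (H ^~ x)}) ->
  (forall x : R, 0 < x -> H 0 x = H0 x) ->
  (forall x : R, 0 < x -> {for x, continuous H0}) ->
  \int[leb]_(x in `[e n, (e n)^-1]) (H (e n) x * f x) @[n --> \oo] -->
  \int[leb]_(x in Rpos) (H0 x * f x).
Proof.
move=> C0 intf e0 ecvg cH HC H0c H0E cH0.
pose F n x := (((fun x => H (e n) x * f x) \_ (`[e n, (e n)^-1] : set R)) x)%:E.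
have sub n : (`[e n, (e n)^-1] : set R) `<=` Rpos.
  by move=> x /=; rewrite !in_itv/= andbT => /andP[/(lt_le_trans (e0 n))].
have FE n : \int[leb]_(x in `[e n, (e n)^-1]) (H (e n) x * f x) =
    fine (\int[leb]_(x in Rpos) F n x)%E.
  by rewrite -{1}(setIidr (sub n)) Rintegral_mkcondr.
under eq_fun do rewrite FE.
have mf : measurable_fun Rpos f by apply/measurable_EFinP; exact: measurable_int intf.
have intg : leb.-integrable Rpos (fun x => (C * `|f x|)%:E).
  exact: (@integrableZl _ _ _ leb _ _ C _ (integrable_norm intf)).
have FC n x : Rpos x -> (`|F n x| <= (C * `|f x|)%:E)%E.
  move=> x0; rewrite /F lee_fin patchE; case: ifPn => [|_].
    by rewrite inE/= in_itv/= => xI; rewrite normrM ler_wpM2r// HC.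
  by rewrite normr0 mulr_ge0.
have mF n : measurable_fun Rpos (F n).
  apply/measurable_EFinP.
  apply/measurable_restrict => //; rewrite (setIidr (sub n)).
  apply: (measurable_funS _ (sub n)) => //; apply: measurable_funM => //.
  by apply: measurable_pos_continuous => x; exact: cH.
have mH : measurable_fun Rpos (fun x => (H0 x * f x)%:E).
  by apply/measurable_EFinP; apply: measurable_funM => //; exact: measurable_pos_continuous.
have Fcvg x : Rpos x -> F n x @[n --> \oo] --> (H0 x * f x)%:E.
  move=> x0; apply: cvg_EFin; first exact: nearW.
  have {}x0 : 0 < x by move: x0; rewrite /= in_itv/= andbT.
  apply: (@cvg_trans _ (H (e n) x * f x @[n --> \oo])).
    apply: near_eq_cvg; near=> n; rewrite /= patchE ifT//= inE/= in_itv/=.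
    have h1 : e n < x by near: n; apply: (cvgr_lt _ ecvg).
    have h2 : e n < x^-1 by near: n; apply: (cvgr_lt _ ecvg); rewrite invr_gt0.
    rewrite (ltW h1)/=; apply/ltW.
    by rewrite -[x]invrK ltf_pV2 ?posrE ?invr_gt0.
  apply: cvgM; last exact: cvg_cst.
  rewrite -H0E//; apply: (@cvg_comp _ _ _ e (H ^~ x) _ (nbhs 0)) => //.
  exact: H0c.
have [] := @dominated_convergence _ _ _ leb Rpos (measurable_itv _) F
  (fun x => (H0 x * f x)%:E) (fun x => (C * `|f x|)%:E) mF mH.
- exact: aeW.
- exact: intg.
- by apply: aeW => x n; exact: FC.
- by move=> h1 _ h2; apply: fine_cvg; rewrite fineK//; exact: integrable_fin_num h1.
Unshelve. all: by end_near. Qed.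

End truncation.

(** * The cut-off function *)

Section cutoff.
Context {R : realType}.
Implicit Types e x : R.

(* [cutoff e x = (1 - e / x) * (1 - x * e)] vanishes at both ends of [[e, e^-1]];
   its square is the actual cut-off function. *)
Definition cutoff e x : R := 1 + e ^+ 2 - (x + x^-1) * e.
Definition cutoff1 e x : R := - (1 - (x ^+ 2)^-1) * e.
Definition cutoff2 e x : R := - (2 * (x ^+ 3)^-1) * e.
Definition sqcutoff e x : R := cutoff e x ^+ 2.
Definition sqcutoff1 e x : R := 2 * cutoff e x * cutoff1 e x.
Definition sqcutoff2 e x : R := 2 * (cutoff1 e x ^+ 2 + cutoff e x * cutoff2 e x).

Lemma is_derive_cutoff e x : 0 < x -> is_derive x 1 (cutoff e) (cutoff1 e x).
Proof.
move=> x0; have xn : x != 0 by rewrite gt_eqF.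
by rewrite /cutoff; derive_eq; rewrite /cutoff1; field.
Qed.

Lemma is_derive_cutoff1 e x : 0 < x -> is_derive x 1 (cutoff1 e) (cutoff2 e x).
Proof.
move=> x0; have xn : x != 0 by rewrite gt_eqF.
rewrite /cutoff1; derive_eq; first by rewrite expf_neq0.
by rewrite /cutoff2; field.
Qed.

Lemma is_derive_sqcutoff e x : 0 < x -> is_derive x 1 (sqcutoff e) (sqcutoff1 e x).
Proof.
move=> x0; have d1 := is_derive_cutoff e x0.
by rewrite /sqcutoff; derive_eq.
Qed.

Lemma is_derive_sqcutoff1 e x : 0 < x -> is_derive x 1 (sqcutoff1 e) (sqcutoff2 e x).
Proof.
move=> x0; have d1 := is_derive_cutoff e x0; have d2 := is_derive_cutoff1 e x0.
rewrite /sqcutoff1; derive_eq; rewrite /sqcutoff2; ring.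
Qed.

Lemma continuous_sqcutoff2 e x : 0 < x -> {for x, continuous (sqcutoff2 e)}.
Proof.
move=> x0; have xn : x != 0 by rewrite gt_eqF.
have c1 := is_derive_continuous (is_derive_cutoff e x0).
have c2 := is_derive_continuous (is_derive_cutoff1 e x0).
have c3 : {for x, continuous (cutoff2 e)}.
  by rewrite /cutoff2; repeat continuous_step; rewrite ?expf_neq0.
by rewrite /sqcutoff2; repeat continuous_step.
Qed.

Lemma sqcutoff0 e : 0 < e -> [/\ sqcutoff e e = 0, sqcutoff e e^-1 = 0,
  sqcutoff1 e e = 0 & sqcutoff1 e e^-1 = 0].
Proof.
move=> e0; have en : e != 0 by rewrite gt_eqF.
have c1 : cutoff e e = 0 by rewrite /cutoff; field.
have c2 : cutoff e e^-1 = 0 by rewrite /cutoff; field.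
by split; rewrite /sqcutoff /sqcutoff1 ?c1 ?c2 ?expr0n ?mulr0 ?mul0r.
Qed.

(** Put y = x e and z = e / x, both in [0, 1] on the interval. Then [cutoff e x] is (1 - y)(1 - z),
    and x d/dx sends y to y and z to -z. Derivatives weighted by the matching power of [x] are
    therefore polynomials in y and z, bounded independently of [e]. *)
Lemma sqcutoff_bounds e x : 0 < e -> e <= x <= e^-1 ->
  [/\ `|sqcutoff e x| <= 1, `|x * sqcutoff1 e x| <= 2 & `|x ^+ 2 * sqcutoff2 e x| <= 6].
Proof.
move=> e0 /andP[ex xe].
have x0 : 0 < x := lt_le_trans e0 ex.
have xn : x != 0 by rewrite gt_eqF.
have y1 : 0 <= x * e <= 1.
  by rewrite (mulr_ge0 (ltW x0) (ltW e0))/= -ler_pdivlMr// div1r.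
have y2 : 0 <= e / x <= 1.
  by rewrite (divr_ge0 (ltW e0) (ltW x0))/= ler_pdivrMr// mul1r.
rewrite (_ : sqcutoff e x = ((1 - x * e) * (1 - e / x)) ^+ 2); last first.
  by rewrite /sqcutoff /cutoff; field.
rewrite (_ : x * sqcutoff1 e x = 2 * (((1 - x * e) * (1 - e / x)) * (e / x - x * e))); last first.
  by rewrite /sqcutoff1 /cutoff /cutoff1; field.
rewrite (_ : x ^+ 2 * sqcutoff2 e x = 2 * ((e / x - x * e) ^+ 2 -
     2 * (((1 - x * e) * (1 - e / x)) * (e / x)))); last first.
  by rewrite /sqcutoff2 /cutoff /cutoff1 /cutoff2; field.
move: (x * e) (e / x) y1 y2 => y z /andP[y0 y1] /andP[z0 z1].
have p0 : 0 <= (1 - y) * (1 - z) by rewrite mulr_ge0 ?subr_ge0.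
have p1 : (1 - y) * (1 - z) <= 1 by rewrite mulr_ile1 ?subr_ge0// gerBl.
move: ((1 - y) * (1 - z)) p0 p1 => p p0 p1.
split.
- by rewrite normrX exprn_ile1// ger0_norm.
- have q : `|z - y| <= 1 by rewrite ler_norml; apply/andP; split; lra.
  by rewrite normrM ger0_norm// ler_piMr// normrM (ger0_norm p0) mulr_ile1.
- have q1 : (z - y) ^+ 2 <= 1.
    rewrite -(real_normK (num_real (z - y))) exprn_ile1// ler_norml.
    by apply/andP; split; lra.
  have q0 := sqr_ge0 (z - y).
  have s0 : 0 <= p * z by rewrite mulr_ge0.
  have s1 : p * z <= 1 by rewrite mulr_ile1.
  by rewrite ler_norml; apply/andP; split; lra.
Qed.

Lemma sqcutoff_at0 x : 0 < x -> [/\ sqcutoff 0 x = 1, sqcutoff1 0 x = 0 & sqcutoff2 0 x = 0].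
Proof.
move=> x0; rewrite /sqcutoff /sqcutoff1 /sqcutoff2 /cutoff /cutoff1 /cutoff2.
by split; ring.
Qed.

Lemma continuous_sqcutoff_at0 x : 0 < x -> [/\ {for 0, continuous (sqcutoff ^~ x)},
  {for 0, continuous (sqcutoff1 ^~ x)} & {for 0, continuous (sqcutoff2 ^~ x)}].
Proof.
move=> x0; rewrite /sqcutoff /sqcutoff1 /sqcutoff2 /cutoff /cutoff1 /cutoff2.
by split; repeat continuous_step.
Qed.

End cutoff.

(** * The conserved quantity *)

Section conserved.
Context {R : realType}.
Notation leb := (@lebesgue_measure R).
Notation Rpos := (`]0%R, +oo[ : set R).

Lemma ler_normM (x y X Y : R) : `|x| <= X -> `|y| <= Y -> `|x * y| <= X * Y.
Proof. by move=> hx hy; rewrite normrM ler_pM. Qed.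

Variables (beta gamma mu : R).

(* [(d/dt + L) (sqcutoff * (b * (1 - expR (- (a * x)))))] for [a, b] as below, [L]
   being the generator of the diffusion. *)
Definition test_image (a b e x : R) : R :=
  sqcutoff e x * (gamma * mu * a * b)
  + 2 * mu * x * sqcutoff1 e x * (a * b * expR (- (a * x)))
  + b * (1 - expR (- (a * x)))
    * ((beta * x + gamma * mu) * sqcutoff1 e x + mu * x * sqcutoff2 e x).

(** The bound must be free of [e], since it provides the majorant as [e] tends to 0. Its five terms
    bound the five products into which the expression is split. *)
Lemma test_image_bound (A a b e x : R) : 0 < gamma -> 0 < mu ->
  0 <= a <= A -> 0 <= b <= 1 -> 0 < e -> e <= x <= e^-1 ->
  `|test_image a b e x| <=
    gamma * mu * A + 4 * (mu * A) + 2 * `|beta| + 2 * (gamma * mu * A) + 6 * (mu * A).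
Proof.
move=> g0 m0 /andP[a0 aA] /andP[b0 b1] e0 xI.
have [k0 k1 k2] := sqcutoff_bounds e0 xI.
have x0 : 0 < x by case/andP: xI => /(lt_le_trans e0).
have xn : x != 0 by rewrite gt_eqF.
have ax0 : 0 <= a * x by rewrite mulr_ge0// ltW.
set E := expR (- (a * x)).
have E0 : 0 <= E by exact: expR_ge0.
have E1 : E <= 1 by rewrite expR_le1 oppr_le0.
(* This is where vanishing to first order at [0] acts: 1 - exp(-a x) <= a x, so the quotient is at
   most [A], and the factor [x] taken out of 1 - E supplies the weight missing in front of the
   derivatives of the cut-off. *)
pose r := (1 - E) / x.
have r0 : `|r| <= A.
  rewrite ger0_norm ?divr_ge0 ?subr_ge0 ?(ltW x0)//.
  rewrite ler_pdivrMr// (@le_trans _ _ (a * x))//; last by rewrite ler_pM2r.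
  by rewrite lerBlDr -lerBlDl; have := expR_ge1Dx (- (a * x)).
have -> : test_image a b e x =
    sqcutoff e x * ((gamma * mu) * (a * b))
    + (x * sqcutoff1 e x) * (2 * (mu * ((a * b) * E)))
    + (b * (1 - E)) * (beta * (x * sqcutoff1 e x))
    + (b * r) * ((gamma * mu) * (x * sqcutoff1 e x))
    + (b * r) * (mu * (x ^+ 2 * sqcutoff2 e x)).
  by rewrite /test_image -/E /r; field.
have na : `|a| <= A by rewrite ger0_norm.
have nb : `|b| <= 1 by rewrite ger0_norm.
have nE : `|E| <= 1 by rewrite ger0_norm.
have nE' : `|1 - E| <= 1 by rewrite ger0_norm ?subr_ge0// gerBl.
have ng : `|gamma * mu| <= gamma * mu by rewrite ger0_norm// mulr_ge0// ltW.
have nm : `|mu| <= mu by rewrite ger0_norm// ltW.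
have n2 : `|2 : R| <= 2 by rewrite ger0_norm.
have h1 := ler_normM k0 (ler_normM ng (ler_normM na nb)).
have h2 := ler_normM k1 (ler_normM n2 (ler_normM nm (ler_normM (ler_normM na nb) nE))).
have h3 := ler_normM (ler_normM nb nE') (ler_normM (lexx `|beta|) k1).
have h4 := ler_normM (ler_normM nb r0) (ler_normM ng k1).
have h5 := ler_normM (ler_normM nb r0) (ler_normM nm k2).
do 4 (rewrite (le_trans (ler_normD _ _))//; rewrite -?addrA ?addrA; apply: lerD; last by
  first [apply: (le_trans h5); nra | apply: (le_trans h4); nra | apply: (le_trans h3); nra
    | apply: (le_trans h2); nra]).
by apply: (le_trans h1); nra.
Qed.

Variables (h ht hx hxx : R -> R -> R).
Hypotheses (gamma_gt0 : 0 < gamma) (mu_gt0 : 0 < mu).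
Hypothesis h_dt : forall x t : R, 0 < x -> 0 < t -> is_derive t 1 (h x) (ht x t).
Hypothesis h_dx : forall x t : R, 0 < x -> 0 < t -> is_derive x 1 (h ^~ t) (hx x t).
Hypothesis h_dxx : forall x t : R, 0 < x -> 0 < t -> is_derive x 1 (hx ^~ t) (hxx x t).
Hypothesis h_cont : forall v, continuous_on_strip v h.
Hypothesis ht_cont : forall v, continuous_on_strip v ht.
Hypothesis h_pde : forall x t : R, 0 < x -> 0 < t ->
  ht x t = - (beta * h x t + (beta * x + gamma * mu) * hx x t)
           + 2 * mu * hx x t + mu * x * hxx x t.
Hypothesis h_ge0 : forall x t : R, 0 < x -> 0 < t -> 0 <= h x t.
Hypothesis h_int : forall t : R, 0 < t -> leb.-integrable Rpos (EFin \o (h ^~ t)).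
Hypothesis h_mass : forall t : R, 0 < t -> \int[leb]_(x in Rpos) h x t = 1.

Variables (a b : R -> R) (v A t1 t2 : R).
Hypotheses (t1_gt0 : 0 < t1) (t12 : t1 < t2) (t2v : t2 < v).
Hypothesis a_dt : forall t : R, 0 < t < v -> is_derive t 1 a (mu * a t ^+ 2 - beta * a t).
Hypothesis b_dt : forall t : R, 0 < t < v -> is_derive t 1 b (gamma * mu * a t * b t).
Hypothesis a_bnd : forall t : R, t1 <= t <= t2 -> 0 <= a t <= A.
Hypothesis b_bnd : forall t : R, t1 <= t <= t2 -> 0 <= b t <= 1.

Lemma cutoff_weak_form (e : R) : 0 < e < 1 ->
  let theta x t := b t * (1 - expR (- (a t * x))) in
  (forall t, 0 < t < v -> {for t, continuous (fun t => \int[leb]_(x in `[e, e^-1])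
     (test_image (a t) (b t) e x * h x t))}) /\
  \int[leb]_(x in `[e, e^-1]) (sqcutoff e x * theta x t2 * h x t2)
    - \int[leb]_(x in `[e, e^-1]) (sqcutoff e x * theta x t1 * h x t1)
  = \int[leb]_(t in `[t1, t2]) \int[leb]_(x in `[e, e^-1])
     (test_image (a t) (b t) e x * h x t).
Proof.
move=> /andP[e0 e1] theta.
pose k x t := sqcutoff e x * theta x t.
pose kt x t := sqcutoff e x * (gamma * mu * a t * b t * (1 - expR (- (a t * x)))
  + b t * ((mu * a t ^+ 2 - beta * a t) * x * expR (- (a t * x)))).
pose kx x t := sqcutoff1 e x * theta x t + sqcutoff e x * (a t * b t * expR (- (a t * x))).
pose kxx x t := sqcutoff2 e x * theta x t
  + 2 * sqcutoff1 e x * (a t * b t * expR (- (a t * x)))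
  - sqcutoff e x * (a t ^+ 2 * b t * expR (- (a t * x))).
have CA x t : 0 < x -> 0 < t < v -> [/\ {for (x, t), continuous (fun q : R * R => a q.2)},
  {for (x, t), continuous (fun q : R * R => b q.2)} &
  [/\ {for (x, t), continuous (fun q : R * R => sqcutoff e q.1)},
  {for (x, t), continuous (fun q : R * R => sqcutoff1 e q.1)} &
  {for (x, t), continuous (fun q : R * R => sqcutoff2 e q.1)}]].
  move=> x0 tv; split; [| |split].
  - by apply: continuous_rule_comp_snd; exact: is_derive_continuous (a_dt tv).
  - by apply: continuous_rule_comp_snd; exact: is_derive_continuous (b_dt tv).
  - by apply: continuous_rule_comp_fst; exact: is_derive_continuous (is_derive_sqcutoff e x0).
  - by apply: continuous_rule_comp_fst; exact: is_derive_continuous (is_derive_sqcutoff1 e x0).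
  - by apply: continuous_rule_comp_fst; exact: continuous_sqcutoff2.
have dE (x t : R) : is_derive x 1 (fun y => expR (- (a t * y))) (expR (- (a t * x)) * - a t).
  apply: derive_rule_expR; apply: derive_ruleN.
  by derive_eq; ring.
have := @weak_form R beta gamma mu h ht hx hxx h_dt h_dx h_dxx h_cont ht_cont h_pde
  v e e^-1 k kt kx kxx t1 t2 e0 _ t1_gt0 t12 t2v.
(* With the equations for [a] and [b] built into [kt], the terms in which the cut-off is not
   differentiated collapse to [sqcutoff e x * (gamma * mu * a t * b t)]. *)
have E x t : (kt x t + (beta * x + gamma * mu) * kx x t + mu * x * kxx x t) * h x t =
    test_image (a t) (b t) e x * h x t.
  by rewrite /kt /kx /kxx /theta /test_image; ring.
have -> : (fun t => \int[leb]_(x in `[e, e^-1])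
     ((kt x t + (beta * x + gamma * mu) * kx x t + mu * x * kxx x t) * h x t)) =
   (fun t => \int[leb]_(x in `[e, e^-1]) (test_image (a t) (b t) e x * h x t)).
  by apply/funext => t; apply: eq_Rintegral => x _; exact: E.
apply.
- by rewrite (lt_trans e1)// invf_gt1.
- by move=> x t x0 tv; have [? ? [? ? ?]] := CA x t x0 tv; rewrite /k /theta; repeat continuous_step.
- by move=> x t x0 tv; have [? ? [? ? ?]] := CA x t x0 tv; rewrite /kt; repeat continuous_step.
- by move=> x t x0 tv; have [? ? [? ? ?]] := CA x t x0 tv; rewrite /kx /theta; repeat continuous_step.
- by move=> x t x0 tv; have [? ? [? ? ?]] := CA x t x0 tv; rewrite /kxx /theta; repeat continuous_step.
- move=> x t x0 tv; have d1 := a_dt tv; have d2 := b_dt tv.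
  by rewrite /k /theta; derive_eq; rewrite ?expr1/= /kt; ring.
- move=> x t x0 tv; have d1 := is_derive_sqcutoff e x0; have d2 := dE x t.
  by rewrite /k /theta; derive_eq; rewrite ?expr1/= /kx /theta; ring.
- move=> x t x0 tv; have d1 := is_derive_sqcutoff e x0; have d2 := dE x t.
  have d3 := is_derive_sqcutoff1 e x0.
  by rewrite /kx /theta; derive_eq; rewrite ?expr1/= /kxx /theta; ring.
(* Squaring the cut-off gives a double zero at each end, as [weak_form] requires. *)
- move=> t tv; have [z1 z2 z3 z4] := sqcutoff0 e0.
  by rewrite /k /kx z1 z2 z3 z4; split; ring.
Qed.

(** Starting at 1/2 keeps [trunc n] below 1, hence below its inverse. *)
Let trunc (n : nat) : R := n.+2%:R^-1.

Let trunc_gt0 n : 0 < trunc n. Proof. by rewrite invr_gt0. Qed.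

Let trunc_lt1 n : trunc n < 1. Proof. by rewrite invf_lt1// ltr1n. Qed.

Let trunc_cvg : trunc n @[n --> \oo] --> 0.
Proof. by have := @cvg_harmonic R; rewrite -cvg_shiftS. Qed.

Let cvg_theta t : t1 <= t <= t2 ->
  \int[leb]_(x in `[trunc n, (trunc n)^-1])
    (sqcutoff (trunc n) x * (b t * (1 - expR (- (a t * x)))) * h x t) @[n --> \oo]
  --> \int[leb]_(x in Rpos) (b t * (1 - expR (- (a t * x))) * h x t).
Proof.
move=> tI; have /andP[b0 b1] := b_bnd tI; have /andP[a0 aA] := a_bnd tI.
have t0 : 0 < t by case/andP: tI => /(lt_le_trans t1_gt0).
apply: (@cvg_Rintegral_trunc _ (h ^~ t)
  (fun e x => sqcutoff e x * (b t * (1 - expR (- (a t * x))))) _ 1) => //.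
- exact: h_int.
- move=> n x x0.
  have c1 := is_derive_continuous (is_derive_sqcutoff (trunc n) x0).
  by repeat continuous_step.
- move=> n x xI; have [k0 _ _] := sqcutoff_bounds (trunc_gt0 n) xI.
  have x0 : 0 < x by case/andP: xI => /(lt_le_trans (trunc_gt0 n)).
  have E1 : expR (- (a t * x)) <= 1 by rewrite expR_le1 oppr_le0 mulr_ge0// ltW.
  have nb : `|b t| <= 1 by rewrite ger0_norm.
  have nE : `|1 - expR (- (a t * x))| <= 1.
    by rewrite ger0_norm ?subr_ge0// gerBl expR_ge0.
  by have := ler_normM k0 (ler_normM nb nE); rewrite !mulr1.
- move=> x x0; have [c1 _ _] := continuous_sqcutoff_at0 x0.
  by apply: continuous_ruleM => //; exact: continuous_rule_cst.
- by move=> x x0; have [-> _ _] := sqcutoff_at0 x0; rewrite mul1r.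
- by move=> x x0; repeat continuous_step.
Qed.

(** Only the undifferentiated cut-off survives in the limit, with a coefficient constant in [x], so
    the unit mass of [h] gives the value. *)
Let cvg_image t : t1 <= t <= t2 ->
  \int[leb]_(x in `[trunc n, (trunc n)^-1]) (test_image (a t) (b t) (trunc n) x * h x t)
    @[n --> \oo] --> gamma * mu * a t * b t.
Proof.
move=> tI; have t0 : 0 < t by case/andP: tI => /(lt_le_trans t1_gt0).
rewrite -[X in _ --> X]mulr1 -(h_mass t0) -RintegralZl//; last exact: h_int.
apply: (@cvg_Rintegral_trunc _ (h ^~ t) (test_image (a t) (b t)) _
  (gamma * mu * A + 4 * (mu * A) + 2 * `|beta| + 2 * (gamma * mu * A) + 6 * (mu * A))) => //.
- have A0 : 0 <= A by have /andP[a0 aA] := a_bnd tI; exact: le_trans aA.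
  have gm := mulr_gt0 gamma_gt0 mu_gt0.
  by rewrite !addr_ge0// ?mulr_ge0// ?mulr_ge0 ?ltW.
- exact: h_int.
- move=> n x x0.
  have c1 := is_derive_continuous (is_derive_sqcutoff (trunc n) x0).
  have c2 := is_derive_continuous (is_derive_sqcutoff1 (trunc n) x0).
  have c3 := @continuous_sqcutoff2 _ (trunc n) _ x0.
  by rewrite /test_image; repeat continuous_step.
- by move=> n x xI; apply: test_image_bound => //; [exact: a_bnd|exact: b_bnd].
- move=> x x0; have [c1 c2 c3] := continuous_sqcutoff_at0 x0.
  by rewrite /test_image; repeat continuous_step.
- move=> x x0; have [k0 k1 k2] := sqcutoff_at0 x0.
  by rewrite /test_image k0 k1 k2; ring.
- by move=> x x0; exact: continuous_rule_cst.
Qed.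

Lemma conserved_laplace :
  \int[leb]_(x in Rpos) (b t2 * (1 - expR (- (a t2 * x))) * h x t2)
  - \int[leb]_(x in Rpos) (b t1 * (1 - expR (- (a t1 * x))) * h x t1) = b t2 - b t1.
Proof.
pose G n t := \int[leb]_(x in `[trunc n, (trunc n)^-1])
  (test_image (a t) (b t) (trunc n) x * h x t).
have e01 n : 0 < trunc n < 1 by rewrite trunc_gt0 trunc_lt1.
have I1 : t1 <= t1 <= t2 by rewrite lexx ltW.
have I2 : t1 <= t2 <= t2 by rewrite lexx ltW.
have L := cvgB (cvg_theta I2) (cvg_theta I1).
have E n := (cutoff_weak_form (e01 n)).2.
have tv t : t1 <= t <= t2 -> 0 < t < v.
  by move=> /andP[h1 h2]; rewrite (lt_le_trans t1_gt0)//= (le_lt_trans h2).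
have bE : b t2 - b t1 = \int[leb]_(t in `[t1, t2]) (gamma * mu * a t * b t).
  symmetry; apply: (@Rintegral_derive _ (fun t => gamma * mu * a t * b t) b) => //.
    by move=> t t0 tt2; apply: b_dt; rewrite t0 (le_lt_trans tt2).
  move=> t t0 tt2; have tv' : 0 < t < v by rewrite t0 (le_lt_trans tt2).
  have c1 := is_derive_continuous (a_dt tv'); have c2 := is_derive_continuous (b_dt tv').
  by repeat continuous_step.
have cG n t : t1 <= t <= t2 -> {for t, continuous (G n)}.
  by move=> tI; exact: (cutoff_weak_form (e01 n)).1 (tv t tI).
pose C := gamma * mu * A + 4 * (mu * A) + 2 * `|beta| + 2 * (gamma * mu * A) + 6 * (mu * A).
(* The pointwise bound is integrated against [h], whose mass on the truncated interval is at most 1.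
   The resulting constant depends neither on [n] nor on [t] and is the majorant for the time
   integral. *)
have GC n t : t1 <= t <= t2 -> `|G n t| <= C.
  move=> tI; have /andP[t0 _] := tv t tI.
  have sub : (`[trunc n, (trunc n)^-1] : set R) `<=` Rpos.
    by move=> x /=; rewrite !in_itv/= andbT => /andP[/(lt_le_trans (trunc_gt0 n))].
  pose I : set R := `[trunc n, (trunc n)^-1].
  have mI : measurable I by exact: measurable_itv.
  have hI : leb.-integrable I (EFin \o (h ^~ t)).
    exact: (@integrableS _ _ _ leb _ I _ _ mI sub (h_int t0)).
  have CI : leb.-integrable I (EFin \o (fun x => C * h x t)).
    exact: (@integrableZl _ _ _ leb _ _ C _ hI).
  have TI : leb.-integrable I
      (EFin \o (fun x => test_image (a t) (b t) (trunc n) x * h x t)).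
    apply: integrable_segment => // x x0.
    have c1 := is_derive_continuous (is_derive_sqcutoff (trunc n) x0).
    have c2 := is_derive_continuous (is_derive_sqcutoff1 (trunc n) x0).
    have c3 := @continuous_sqcutoff2 _ (trunc n) _ x0.
    have c4 := is_derive_continuous (h_dx x0 t0).
    by rewrite /test_image; repeat continuous_step.
  have C0 : 0 <= C.
    have A0 : 0 <= A by have /andP[a0 aA] := a_bnd tI; exact: le_trans aA.
    by rewrite !addr_ge0// ?mulr_ge0// ?mulr_ge0 ?ltW.
  apply: (le_trans (le_normr_Rintegral _ TI)) => //.
  apply: (@le_trans _ _ (\int[leb]_(x in I) (C * h x t))).
    apply: le_Rintegral => //; first exact: integrable_norm.
    move=> x xI; have x0 : 0 < x by have := sub x xI; rewrite /= in_itv/= andbT.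
    rewrite normrM (ger0_norm (h_ge0 x0 t0)) ler_wpM2r ?h_ge0//.
    apply: test_image_bound => //; [exact: a_bnd|exact: b_bnd].
  rewrite RintegralZl// -[leRHS]mulr1 ler_wpM2l// -(h_mass t0).
  apply: fine_le; [exact: integrable_fin_num|exact: integrable_fin_num (h_int t0)|].
  apply: ge0_subset_integral => //.
    by have /measurable_int := h_int t0.
  by move=> x; rewrite /= in_itv/= andbT => x0; rewrite lee_fin h_ge0.
have cv : \int[leb]_(t in `[t1, t2]) G n t @[n --> \oo] -->
    \int[leb]_(t in `[t1, t2]) (gamma * mu * a t * b t).
  have [] := @dominated_convergence _ _ _ leb `[t1, t2] (measurable_itv _)
    (fun n t => (G n t)%:E) (fun t => (gamma * mu * a t * b t)%:E) (fun=> C%:E).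
  - move=> n; apply/measurable_EFinP; apply: subspace_continuous_measurable_fun => //.
    apply: continuous_in_subspaceT => t; rewrite inE/= in_itv/=; exact: cG.
  - apply/measurable_EFinP; apply: subspace_continuous_measurable_fun => //.
    apply: continuous_in_subspaceT => t; rewrite inE/= in_itv/= => tI.
    have c1 := is_derive_continuous (a_dt (tv t tI)).
    have c2 := is_derive_continuous (b_dt (tv t tI)).
    suff : {for t, continuous (fun t => gamma * mu * a t * b t)} by [].
    by repeat continuous_step.
  - apply: aeW => t /=; rewrite in_itv/= => tI.
    by apply: cvg_EFin; [exact: nearW|exact: cvg_image].
  - by apply: (@integrable_segment _ (fun=> C)) => // x _; exact: continuous_rule_cst.
  - by apply: aeW => t n /=; rewrite in_itv/= => tI; rewrite lee_fin GC.
  - by move=> h1 _ h2; apply: fine_cvg; rewrite fineK//; exact: integrable_fin_num h1.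
have L' : \int[leb]_(t in `[t1, t2]) G n t @[n --> \oo] -->
    \int[leb]_(x in Rpos) (b t2 * (1 - expR (- (a t2 * x))) * h x t2)
    - \int[leb]_(x in Rpos) (b t1 * (1 - expR (- (a t1 * x))) * h x t1).
  pose I t n := \int[leb]_(x in `[trunc n, (trunc n)^-1])
    (sqcutoff (trunc n) x * (b t * (1 - expR (- (a t * x)))) * h x t).
  have -> : (fun n => \int[leb]_(t in `[t1, t2]) G n t) = (fun n => I t2 n - I t1 n).
    by apply/funext => n; exact: esym (E n).
  exact: L.
by rewrite bE -(cvg_lim (@Rhausdorff R) L') -(cvg_lim (@Rhausdorff R) cv).
Qed.

End conserved.

(** * The gamma densities *)

Section inverse_rate.
Context {R : realType}.
Variables (beta mu : R).
Hypothesis mu_gt0 : 0 < mu.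

(** Unlike [psi], which is singular at [0], its reciprocal is smooth on the whole line, vanishes at
    [0] and solves a linear equation. The uniqueness proof also evaluates it at slightly negative
    times. *)
Definition invpsi (t : R) : R :=
  if beta == 0 then mu * t else mu * (expR (beta * t) - 1) / beta.

Lemma psi_invpsi t : psi beta mu t = (invpsi t)^-1.
Proof. by rewrite /psi /invpsi; case: ifP => // _; rewrite !invfM invrK; ring. Qed.

Lemma invpsi0 : invpsi 0 = 0.
Proof. by rewrite /invpsi !mulr0 expR0 subrr mulr0 mul0r; case: ifP. Qed.

(** Both cases of the definition satisfy this affine relation, which gives the differential equation
    one form for all [beta]. *)
Lemma invpsi_expR t : mu * expR (beta * t) = mu + beta * invpsi t.
Proof.
rewrite /invpsi; have [->|b0] := eqVneq beta 0; first by rewrite !mul0r expR0; ring.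
by field.
Qed.

Lemma is_derive_invpsi (t : R) : is_derive t 1 invpsi (mu + beta * invpsi t).
Proof.
rewrite -invpsi_expR /invpsi; have [->|b0] := eqVneq beta 0.
  by derive_eq; rewrite mul0r expR0; ring.
by derive_eq; field.
Qed.

Lemma invpsi_gt0 t : 0 < t -> 0 < invpsi t.
Proof.
move=> t0; rewrite /invpsi; have [_|bn] := eqVneq beta 0; first by rewrite mulr_gt0.
have [b0|b0|b0] := ltgtP beta 0; last by rewrite b0 eqxx in bn.
- rewrite -mulrA mulr_gt0// -mulrNN mulr_gt0//; last by rewrite -invrN invr_gt0 oppr_gt0.
  by rewrite oppr_gt0 subr_lt0 expR_lt1 nmulr_rlt0.
- by rewrite divr_gt0// mulr_gt0// subr_gt0 expR_gt1 mulr_gt0.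
Qed.

Lemma psi_gt0 t : 0 < t -> 0 < psi beta mu t.
Proof. by move=> t0; rewrite psi_invpsi invr_gt0 invpsi_gt0. Qed.

Lemma is_derive_psi (t : R) : 0 < t -> is_derive t 1 (psi beta mu)
  (- (mu * psi beta mu t ^+ 2 + beta * psi beta mu t)).
Proof.
move=> t0; have d := is_derive_invpsi t; have E0 := invpsi_gt0 t0.
have En : invpsi t != 0 by rewrite gt_eqF.
rewrite (_ : psi beta mu = fun t => (invpsi t)^-1); last by apply/funext => s; exact: psi_invpsi.
by derive_eq; field.
Qed.

End inverse_rate.

(** * The candidate density and its partial derivatives *)

Section gamma_density.
Context {R : realType}.
Notation leb := (@lebesgue_measure R).
Notation Rpos := (`]0%R, +oo[ : set R).
Variables (beta gamma mu : R).
Hypotheses (gamma_gt0 : 0 < gamma) (mu_gt0 : 0 < mu).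
Notation psi := (psi beta mu).

Definition gdens (x t : R) : R :=
  psi t `^ gamma / Gamma gamma * x `^ (gamma - 1) * expR (- (x * psi t)).
(** By logarithmic differentiation this and the next two derivatives are [gdens] times a rational
    function of [x] and [psi t], so that the Fokker-Planck equation becomes a rational identity. *)
Definition gdens_t (x t : R) : R :=
  - (gdens x t * ((gamma * (mu * psi t + beta)) - x * (mu * psi t ^+ 2 + beta * psi t))).
Definition gdens_x (x t : R) : R := gdens x t * ((gamma - 1) / x - psi t).
Definition gdens_xx (x t : R) : R :=
  gdens x t * (((gamma - 1) / x - psi t) ^+ 2 - (gamma - 1) / x ^+ 2).

Lemma powRB1 (x c : R) : 0 < x -> x `^ (c - 1) = x `^ c / x.
Proof. by move=> x0; rewrite powRB ?powRr1 ?(ltW x0)// (gt_eqF x0) implybT. Qed.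

Lemma gdens_gt0 x t : 0 < x -> 0 < t -> 0 < gdens x t.
Proof.
move=> x0 t0; rewrite !mulr_gt0 ?expR_gt0 ?powR_gt0 ?invr_gt0 ?Gamma_gt0//.
by rewrite psi_gt0.
Qed.

Lemma is_derive_gdens_t (x t : R) : 0 < x -> 0 < t -> is_derive t 1 (gdens x) (gdens_t x t).
Proof.
move=> x0 t0; have p0 := psi_gt0 beta mu_gt0 t0; have d := is_derive_psi beta mu_gt0 t0.
have pn : psi t != 0 by rewrite gt_eqF.
have gn : Gamma gamma != 0 by rewrite gt_eqF// Gamma_gt0.
rewrite /gdens; derive_eq; rewrite /gdens_t /gdens (powRB1 _ p0).
by field; rewrite gn.
Qed.

Lemma is_derive_gdens_x (x t : R) : 0 < x -> 0 < t -> is_derive x 1 (gdens ^~ t) (gdens_x x t).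
Proof.
move=> x0 t0; have xn : x != 0 by rewrite gt_eqF.
rewrite /gdens; derive_eq; rewrite /gdens_x /gdens (powRB1 (gamma - 1) x0).
have gn : Gamma gamma != 0 by rewrite gt_eqF// Gamma_gt0.
by field; rewrite gn xn.
Qed.

Lemma is_derive_gdens_xx (x t : R) : 0 < x -> 0 < t -> is_derive x 1 (gdens_x ^~ t) (gdens_xx x t).
Proof.
move=> x0 t0; have xn : x != 0 by rewrite gt_eqF.
have d := is_derive_gdens_x x0 t0.
by rewrite /gdens_x; derive_eq; rewrite /gdens_xx /gdens_x; field.
Qed.

Lemma gdens_pde x t : 0 < x -> gdens_t x t =
  - (beta * gdens x t + (beta * x + gamma * mu) * gdens_x x t)
  + 2 * mu * gdens_x x t + mu * x * gdens_xx x t.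
Proof.
move=> x0; have xn : x != 0 by rewrite gt_eqF.
by rewrite /gdens_t /gdens_x /gdens_xx; field.
Qed.

Lemma continuous_gdens (x t : R) : 0 < x -> 0 < t -> [/\
  {for (x, t), continuous (fun p => gdens p.1 p.2)},
  {for (x, t), continuous (fun p => gdens_t p.1 p.2)},
  {for (x, t), continuous (fun p => gdens_x p.1 p.2)} &
  {for (x, t), continuous (fun p => gdens_xx p.1 p.2)}].
Proof.
move=> x0 t0; have xn : x != 0 by rewrite gt_eqF.
have c1 : {for (x, t), continuous (fun p : R * R => psi p.2)}.
  by apply: continuous_rule_comp_snd; exact: is_derive_continuous (is_derive_psi beta mu_gt0 t0).
have c2 : {for (x, t), continuous (fun p : R * R => psi p.2 `^ gamma)}.
  apply: (@continuous_rule_comp_snd _ (fun s => psi s `^ gamma)).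
  have d := is_derive_psi beta mu_gt0 t0.
  by apply: is_derive_continuous; repeat derive_step; rewrite psi_gt0.
have c3 : {for (x, t), continuous (fun p : R * R => p.1 `^ (gamma - 1))}.
  apply: (@continuous_rule_comp_fst _ (fun s => s `^ (gamma - 1))).
  by apply: is_derive_continuous; repeat derive_step.
have c4 : {for (x, t), continuous (fun p : R * R => p.1)} by exact: continuous_rule_fst.
have c5 : {for (x, t), continuous (fun p => gdens p.1 p.2)}.
  by rewrite /gdens; repeat continuous_step.
split=> //; rewrite /gdens_t /gdens_x /gdens_xx.
- by repeat continuous_step.
- by repeat continuous_step.
- by repeat continuous_step; rewrite ?expf_neq0.
Qed.

End gamma_density.

(** * Existence *)

Section fokker_planck_terms.
Context {R : realType}.
Variables (f f1 f2 : R -> R).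
Hypothesis f_dx : forall x : R, 0 < x -> is_derive x 1 f (f1 x).
Hypothesis f1_dx : forall x : R, 0 < x -> is_derive x 1 f1 (f2 x).

Lemma derive1_drift (beta c x : R) : 0 < x ->
  derive1 (fun y => (beta * y + c) * f y) x = beta * f x + (beta * x + c) * f1 x.
Proof.
move=> x0; have d := f_dx x0; apply: is_derive_derive1.
by derive_eq; ring.
Qed.

Lemma derive1_diffusion (mu x : R) : 0 < x ->
  derive1 (fun y => 2 * mu * y * f y) x = 2 * mu * f x + 2 * mu * x * f1 x.
Proof.
move=> x0; have d := f_dx x0; apply: is_derive_derive1.
by derive_eq; ring.
Qed.

Lemma derive1n2_diffusion (mu x : R) : 0 < x ->
  derive1n 2 (fun y => 2 * mu * y * f y) x = 4 * mu * f1 x + 2 * mu * x * f2 x.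
Proof.
move=> x0; have d := f_dx x0; have d1 := f1_dx x0; apply: is_derive_derive1.
apply: (@near_eq_is_derive _ _ _ (fun y => 2 * mu * f y + 2 * mu * y * f1 y)).
  by near=> y; rewrite -derive1_diffusion//; near: y; exact: lt_nbhsr.
by derive_eq; ring.
Unshelve. all: by end_near. Qed.

End fokker_planck_terms.

Section existence.
Context {R : realType}.
Notation leb := (@lebesgue_measure R).
Notation Rpos := (`]0%R, +oo[ : set R).

(** A function given by the formula is so only on the quadrant and arbitrary elsewhere; the quadrant
    being open, regularity still transfers. *)
Lemma continuous_quadrant (F G : R * R -> R) (x t : R) : 0 < x -> 0 < t ->
  (forall y s, 0 < y -> 0 < s -> F (y, s) = G (y, s)) ->
  {for (x, t), continuous G} -> {for (x, t), continuous F}.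
Proof.
move=> x0 t0 FG cG.
have FGn : \forall p \near (x, t), G p = F p.
  exists ([set y | 0 < y], [set s | 0 < s]) => /=; first by split; exact: lt_nbhsr.
  by move=> [y s] /= [y0 s0]; rewrite FG.
have : G p @[p --> (x, t)] --> F (x, t) by rewrite FG.
by apply: cvg_trans; exact: near_eq_cvg.
Qed.

Lemma integral_scaled_Gamma (c a l : R) : 0 <= c -> 0 < a -> 0 < l ->
  (\int[leb]_(x in Rpos) (c * (x `^ (a - 1) * expR (- (x * l))))%:E
   = (c * (Gamma a / l `^ a))%:E)%E.
Proof.
move=> c0 a0 l0; rewrite EFinM -integral_Gamma_rate// -ge0_integralZl//.
- apply/measurable_EFinP; apply: measurable_pos_continuous => x x0.
  exact: continuous_powR_expR.
- by move=> x _; rewrite lee_fin mulr_ge0 ?powR_ge0 ?expR_ge0.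
Qed.

Variables (beta gamma mu : R).
Hypotheses (gamma_gt0 : 0 < gamma) (mu_gt0 : 0 < mu).
Notation psi := (psi beta mu).
Notation gdens := (gdens beta gamma mu).

Let scale_ge0 t : 0 <= psi t `^ gamma / Gamma gamma.
Proof. by rewrite divr_ge0 ?powR_ge0// ltW// Gamma_gt0. Qed.

Lemma integral_gdens (t : R) : 0 < t ->
  (\int[leb]_(x in Rpos) (gdens x t)%:E = 1)%E.
Proof.
move=> t0; have p0 := psi_gt0 beta mu_gt0 t0.
under eq_integral do rewrite /gdens -mulrA.
rewrite integral_scaled_Gamma//; congr EFin; field.
by rewrite !gt_eqF ?powR_gt0 ?Gamma_gt0.
Qed.

(** The ratio [Gamma (gamma + 1) / Gamma gamma] stays unevaluated: for the initial condition it is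
    enough that the first moment is a constant times [invpsi]. *)
Lemma integral_id_gdens (t : R) : 0 < t ->
  (\int[leb]_(x in Rpos) (x * gdens x t)%:E =
   (Gamma (gamma + 1) / Gamma gamma * invpsi beta mu t)%:E)%E.
Proof.
move=> t0; have p0 := psi_gt0 beta mu_gt0 t0.
have E x : x \in Rpos -> (x * gdens x t)%:E =
    (psi t `^ gamma / Gamma gamma * (x `^ ((gamma + 1) - 1) * expR (- (x * psi t))))%:E.
  rewrite inE/= in_itv/= andbT => x0; congr EFin.
  by rewrite /gdens addrK -(mulr_powRB1 (ltW x0) gamma_gt0); ring.
under eq_integral => x xI do rewrite (E x xI).
rewrite integral_scaled_Gamma ?addr_gt0//; congr EFin.
rewrite powRD ?(gt_eqF p0) ?implybT// powRr1 ?(ltW p0)//.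
rewrite -[invpsi _ _ _]invrK -psi_invpsi; field.
by rewrite !gt_eqF ?powR_gt0 ?Gamma_gt0.
Qed.

Variable h : R -> R -> R.
Hypothesis hE : forall x t : R, 0 < x -> 0 < t -> h x t = gdens x t.

Let pos_of x : Rpos x -> 0 < x. Proof. by rewrite /= in_itv/= andbT. Qed.

Lemma gamma_density (t : R) : 0 < t -> is_density (h ^~ t).
Proof.
move=> t0; split.
- apply: (@eq_measurable_fun _ _ _ _ _ (gdens ^~ t)).
    by move=> x; rewrite inE => /pos_of x0; rewrite hE.
  apply: measurable_pos_continuous => x x0.
  have d := is_derive_gdens_x beta mu gamma_gt0 x0 t0.
  exact: (is_derive_continuous d).
- by move=> x x0; rewrite hE// ltW// gdens_gt0.
- rewrite -(integral_gdens t0); apply: eq_integral => x; rewrite inE => /pos_of x0.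
  by rewrite hE.
Qed.

Lemma gamma_dt (x t : R) : 0 < x -> 0 < t -> is_derive t 1 (h x) (gdens_t beta gamma mu x t).
Proof.
move=> x0 t0; apply: near_eq_is_derive (is_derive_gdens_t beta gamma_gt0 mu_gt0 x0 t0).
by near=> s; rewrite hE//; near: s; exact: lt_nbhsr.
Unshelve. all: by end_near. Qed.

Lemma gamma_dx (x t : R) : 0 < x -> 0 < t -> is_derive x 1 (h ^~ t) (gdens_x beta gamma mu x t).
Proof.
move=> x0 t0; apply: near_eq_is_derive (is_derive_gdens_x beta mu gamma_gt0 x0 t0).
by near=> s; rewrite hE//; near: s; exact: lt_nbhsr.
Unshelve. all: by end_near. Qed.

Lemma gamma_dxx (x t : R) : 0 < x -> 0 < t ->
  is_derive x 1 (derive1 (h ^~ t)) (gdens_xx beta gamma mu x t).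
Proof.
move=> x0 t0; apply: near_eq_is_derive (is_derive_gdens_xx beta mu gamma_gt0 x0 t0).
near=> s; have s0 : 0 < s by near: s; exact: lt_nbhsr.
by rewrite (is_derive_derive1 (gamma_dx s0 t0)).
Unshelve. all: by end_near. Qed.

Lemma gamma_C21 : C21 h.
Proof.
move=> x t x0 t0.
have [c1 c2 c3 c4] := continuous_gdens beta gamma mu_gt0 x0 t0.
split; first split.
- by have [] := gamma_dt x0 t0.
- by have [] := gamma_dx x0 t0.
- by have [] := gamma_dxx x0 t0.
split.
- by apply: continuous_quadrant c1 => // y s y0 s0; rewrite hE.
- apply: continuous_quadrant c2 => // y s y0 s0.
  exact: is_derive_derive1 (gamma_dt y0 s0).
- apply: continuous_quadrant c3 => // y s y0 s0.
  exact: is_derive_derive1 (gamma_dx y0 s0).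
- apply: continuous_quadrant c4 => // y s y0 s0.
  exact: is_derive_derive1 (gamma_dxx y0 s0).
Qed.

Lemma gamma_fokker_planck : fokker_planck beta gamma mu h.
Proof.
move=> x t x0 t0; rewrite (is_derive_derive1 (gamma_dt x0 t0)).
have d1 y (y0 : 0 < y) := gamma_dx y0 t0.
have d2 (y : R) (y0 : 0 < y) : is_derive y 1 (gdens_x beta gamma mu ^~ t) (gdens_xx beta gamma mu y t).
  exact: is_derive_gdens_xx.
rewrite (derive1_drift d1)// (derive1n2_diffusion d1 d2)// hE// gdens_pde//.
by field.
Qed.

(** The terms of order x^(gamma-1), which blow up when gamma < 1, cancel in the flux. It equals
    (beta + mu psi) x h, a multiple of x^gamma exp(-x psi). *)
Lemma gamma_zero_flux : zero_flux beta gamma mu h.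
Proof.
move=> t t0; have d1 y (y0 : 0 < y) := gamma_dx y0 t0.
pose c := psi t `^ gamma / Gamma gamma * (beta + mu * psi t).
apply: (@cvg_trans _ (c * (x `^ gamma * expR (- (x * psi t))) @[x --> 0^'+])).
  apply: near_eq_cvg; near=> x.
  have x0 : 0 < x by near: x; exact: nbhs_right_gt.
  rewrite (derive1_diffusion d1)// hE// /gdens_x /gdens -(mulr_powRB1 (ltW x0) gamma_gt0) /c.
  by field; rewrite !gt_eqF ?Gamma_gt0.
suff H : c * (x `^ gamma * expR (- (x * psi t))) @[x --> 0^'+]
    --> c * (0 * expR (- (0 * psi t))) by rewrite mul0r mulr0 in H.
apply: cvgM; first exact: cvg_cst.
apply: cvgM; first exact: powR_cvg0.
apply: cvg_at_right_filter.
suff : {for 0, continuous (fun x : R => expR (- (x * psi t)))} by [].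
by repeat continuous_step.
Unshelve. all: by end_near. Qed.

(** A Chebyshev-type argument: the oscillation of [f] around [f 0] is bounded by an affine function
    of [x], whose integral involves only the mass and the first moment of [h]. *)
Lemma gamma_starts_at_0 : starts_at_0 h.
Proof.
move=> f cf [M HM].
have M0 : 0 <= M by exact: le_trans (HM 0).
pose C := Gamma (gamma + 1) / Gamma gamma.
have C0 : 0 < C by rewrite divr_gt0 ?Gamma_gt0 ?addr_gt0.
apply/cvgrPdist_le => e e0.
have /cvgrPdist_le/(_ (e / 2)) := cf 0; rewrite divr_gt0// => /(_ isT).
move=> /nbhs_ballP[d /= d0 Hd].
(* Below [d] continuity gives e/2; from [d] on, the linear term is at least the trivial bound 2
   M. *)
have fd x : 0 < x -> `|f x - f 0| <= e / 2 + 2 * M / d * x.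
  move=> x0; have [xd|dx] := ltP x d.
    rewrite distrC (@le_trans _ _ (e / 2))//.
      by apply: Hd; rewrite /ball/= sub0r normrN gtr0_norm.
    by rewrite lerDl mulr_ge0 ?(ltW x0)// mulr_ge0 ?mulr_ge0 ?invr_ge0 ?(ltW d0).
  rewrite (le_trans (ler_normB _ _))// (@le_trans _ _ (2 * M))//.
    by rewrite mulr2n mulrDl mul1r lerD.
  rewrite -[leLHS]add0r lerD ?divr_ge0 ?(ltW e0)// mulrAC ler_pdivlMr//.
  by rewrite ler_wpM2l// mulr_ge0.
have cE : {for 0, continuous (fun t => 2 * M / d * (C * invpsi beta mu t))}.
  have := is_derive_continuous (is_derive_invpsi beta mu 0) => c1.
  by repeat continuous_step.
have : 2 * M / d * (C * invpsi beta mu t) @[t --> 0^'+] --> 0.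
  apply: cvg_at_right_filter; have := cE; rewrite /prop_for/continuous_at invpsi0 !mulr0.
  by [].
move=> /cvgrPdist_le/(_ (e / 2)); rewrite divr_gt0// => /(_ isT) near0.
near=> t.
have t0 : 0 < t by near: t; exact: nbhs_right_gt.
have small : 2 * M / d * (C * invpsi beta mu t) <= e / 2.
  have : `|0 - 2 * M / d * (C * invpsi beta mu t)| <= e / 2 by near: t.
  by rewrite sub0r normrN; apply: le_trans; exact: ler_norm.
have [mh h0 h1] := gamma_density t0.
have hint : leb.-integrable Rpos (EFin \o (h ^~ t)).
  apply/integrableP; split; first exact/measurable_EFinP.
  under eq_integral => x do [rewrite inE => /pos_of x0; rewrite /= ger0_norm ?h0//].
  by rewrite h1 ltry.
have xint : leb.-integrable Rpos (EFin \o (fun x => x * h x t)).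
  apply/integrableP; split; first by apply/measurable_EFinP; exact: measurable_funM.
  under eq_integral => x do [rewrite inE => /pos_of x0; rewrite /= ger0_norm ?mulr_ge0 ?h0 ?(ltW x0)// hE//].
  by rewrite integral_id_gdens// ltry.
have Rh : \int[leb]_(x in Rpos) h x t = 1 by rewrite /Rintegral h1.
have Rxh : \int[leb]_(x in Rpos) (x * h x t) = C * invpsi beta mu t.
  rewrite /Rintegral; under eq_integral => x do [rewrite inE => /pos_of x0; rewrite hE//].
  by rewrite integral_id_gdens.
have mf : measurable_fun Rpos f by apply: measurable_pos_continuous => x _; exact: cf.
have fint : leb.-integrable Rpos (EFin \o (fun x => f x * h x t)).
  rewrite (_ : (fun x => f x * h x t) = (fun x => h x t * f x)).
    by apply: (integrable_mul_bounded _ hint mf (M := M)).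
  by apply/funext => x; rewrite mulrC.
have f0int : leb.-integrable Rpos (EFin \o (fun x => f 0 * h x t)).
  exact: (@integrableZl _ _ _ leb _ _ (f 0) _ hint).
rewrite distrC -[X in _ - X]mulr1 -Rh -RintegralZl// -RintegralB//.
have i1 : leb.-integrable Rpos (EFin \o (fun x => e / 2 * h x t)).
  exact: (@integrableZl _ _ _ leb _ _ (e / 2) _ hint).
have i2 : leb.-integrable Rpos (EFin \o (fun x => 2 * M / d * (x * h x t))).
  exact: (@integrableZl _ _ _ leb _ _ (2 * M / d) _ xint).
have bint : leb.-integrable Rpos (EFin \o (fun x => e / 2 * h x t + 2 * M / d * (x * h x t))).
  exact: (@integrableD _ _ _ leb _ _ _ _ i1 i2).
have dint : leb.-integrable Rpos (EFin \o (fun x => f x * h x t - f 0 * h x t)).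
  exact: (@integrableB _ _ _ leb _ _ _ _ fint f0int).
apply: (le_trans (le_normr_Rintegral _ dint)) => //.
apply: (@le_trans _ _ (\int[leb]_(x in Rpos) (e / 2 * h x t + 2 * M / d * (x * h x t)))).
  apply: le_Rintegral => //; first exact: integrable_norm.
  move=> x /pos_of x0; rewrite -mulrBl normrM (ger0_norm (h0 x x0)).
  by rewrite mulrA -mulrDl ler_wpM2r ?h0// fd.
rewrite RintegralD//.
rewrite RintegralZl// RintegralZl// Rh Rxh mulr1.
by rewrite [leRHS](splitr e) lerD2l.
Unshelve. all: by end_near. Qed.

End existence.

(** * Uniqueness *)

Section uniqueness.
Context {R : realType}.
Notation leb := (@lebesgue_measure R).
Notation Rpos := (`]0%R, +oo[ : set R).
Variables (beta gamma mu : R).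
Hypotheses (gamma_gt0 : 0 < gamma) (mu_gt0 : 0 < mu).
Notation E := (invpsi beta mu).

Lemma derive_rule_comp (f g : R -> R) (x df dg : R) : is_derive (g x) 1 f df ->
  is_derive x 1 g dg -> is_derive x 1 (fun y => f (g y)) (df * dg).
Proof. by move=> ? ?; exact: is_derive1_comp. Qed.

Lemma derivable_is_derive (f : R -> R) (x : R) :
  derivable f x 1 -> is_derive x 1 f (derive1 f x).
Proof. by move=> d; split=> //; rewrite derive1E. Qed.

(* The solution of [a' = mu a^2 - beta a], [b' = gamma mu a b] with [a T = s], [b T = 1]. *)
Definition lap_a (s T t : R) : R := s * (1 + beta * E (T - t) / mu) / (1 + s * E (T - t)).
Definition lap_b (s T t : R) : R := (1 + s * E (T - t)) `^ (- gamma).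

Lemma is_derive_invpsi_rev (T t : R) :
  is_derive t 1 (fun t => E (T - t)) (- (mu + beta * E (T - t))).
Proof.
rewrite -mulrN1; apply: derive_rule_comp; first exact: is_derive_invpsi.
by derive_eq; ring.
Qed.

Lemma is_derive_lap_a (s T t : R) : 0 < 1 + s * E (T - t) ->
  is_derive t 1 (lap_a s T) (mu * lap_a s T t ^+ 2 - beta * lap_a s T t).
Proof.
move=> p0; have pn : 1 + s * E (T - t) != 0 by rewrite gt_eqF.
have mn : mu != 0 by rewrite gt_eqF.
have d := is_derive_invpsi_rev T t.
rewrite /lap_a.
have d1 : is_derive t 1 (fun t => s * (1 + beta * E (T - t) / mu))
    (s * (beta * (- (mu + beta * E (T - t))) / mu)).
  by rewrite (_ : (fun t => s * (1 + beta * E (T - t) / mu)) =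
    (fun t => s * (1 + beta * (fun t => E (T - t)) t / mu)))//; derive_eq; ring.
have d2 : is_derive t 1 (fun t => 1 + s * E (T - t)) (s * (- (mu + beta * E (T - t)))).
  by derive_eq; ring.
have d3 := derive_ruleM d1 (derive_ruleV (f := fun t => 1 + s * E (T - t)) pn d2).
by apply: (derive_rule_eq d3); field; rewrite pn mn.
Qed.

Lemma is_derive_lap_b (s T t : R) : 0 < 1 + s * E (T - t) ->
  is_derive t 1 (lap_b s T) (gamma * mu * lap_a s T t * lap_b s T t).
Proof.
move=> p0; have pn : 1 + s * E (T - t) != 0 by rewrite gt_eqF.
have mn : mu != 0 by rewrite gt_eqF.
have d := is_derive_invpsi_rev T t.
have d2 : is_derive t 1 (fun t => 1 + s * E (T - t)) (s * (- (mu + beta * E (T - t)))).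
  by derive_eq; ring.
have d3 := derive_rule_powR (f := fun t => 1 + s * E (T - t)) (- gamma) p0 d2.
rewrite /lap_b; apply: (derive_rule_eq d3).
by rewrite powRB1// /lap_a; field; rewrite pn mn.
Qed.

Lemma invpsi_ge0 (t : R) : 0 <= t -> 0 <= E t.
Proof.
by rewrite le_eqVlt => /predU1P[<-|t0]; [rewrite invpsi0|rewrite ltW// invpsi_gt0].
Qed.

(** The bound does not depend on [t] and holds down to [t = 0]. It serves as the constant [A] of the
    weak form and as the fixed rate in the comparison at small times. *)
Lemma lap_a_bound (s T t : R) : 0 < s -> 0 < T -> 0 <= t <= T ->
  0 <= lap_a s T t <= s * expR (`|beta| * T).
Proof.
move=> s0 T0 /andP[t0 tT].
have E0 : 0 <= E (T - t) by rewrite invpsi_ge0// subr_ge0.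
have p1 : 1 <= 1 + s * E (T - t) by rewrite lerDl mulr_ge0// ltW.
rewrite /lap_a.
(* By [invpsi_expR] this factor is an exponential, hence positive whatever the sign of [beta]. The
   definition keeps it rational in [E], so that the Riccati equation is a field identity. *)
have -> : 1 + beta * E (T - t) / mu = expR (beta * (T - t)).
  have mn : mu != 0 by rewrite gt_eqF.
  by apply: (mulfI mn); rewrite invpsi_expR; field.
apply/andP; split.
  by rewrite divr_ge0 ?mulr_ge0 ?expR_ge0 ?(ltW s0)// (le_trans ler01).
rewrite ler_pdivrMr ?(lt_le_trans ltr01)// -[leLHS]mulr1 ler_pM//.
- by rewrite mulr_ge0 ?expR_ge0// ltW.
- rewrite ler_pM2l// ler_expR (le_trans (ler_norm _))// normrM ler_wpM2l//.
  by rewrite ger0_norm ?subr_ge0// gerBl.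
Qed.

Lemma lap_b_bound (s T t : R) : 0 < s -> t <= T -> 0 <= lap_b s T t <= 1.
Proof.
move=> s0 tT; rewrite /lap_b powR_ge0/= powRN.
have E0 : 0 <= E (T - t) by rewrite invpsi_ge0// subr_ge0.
have p1 : 1 <= 1 + s * E (T - t) by rewrite lerDl mulr_ge0// ltW.
have : 1 <= (1 + s * E (T - t)) `^ gamma.
  have := @ge0_ler_powR R gamma (ltW gamma_gt0) 1 (1 + s * E (T - t)).
  by rewrite powR1 !nnegrE; apply=> //; exact: le_trans p1.
by move=> h1; rewrite invf_le1// (lt_le_trans ltr01).
Qed.

(** The weak form differentiates on both sides of the terminal time [T]. Past [T] the argument of
    [E] is negative and the denominator may decrease to 0, but by continuity it stays positive for a
    while. *)
Lemma laplace_window (s T : R) : 0 < s -> 0 < T -> exists2 v, T < v &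
  forall t, 0 < t < v -> 0 < 1 + s * E (T - t).
Proof.
move=> s0 T0; have d := is_derive_invpsi_rev T T.
have c : {for T, continuous (fun t => 1 + s * E (T - t))}.
  have c1 := is_derive_continuous d.
  by repeat continuous_step.
have : \forall t \near T, 0 < 1 + s * E (T - t).
  apply: (cvgr_gt _ c); rewrite subrr invpsi0 mulr0 addr0//.
move=> /nbhs_ballP[e /= e0 He]; exists (T + e); first by rewrite ltrDl.
move=> t /andP[t0 tv]; have [tT|Tt] := leP t T.
  by rewrite ltr_pwDl// mulr_ge0 ?(ltW s0)// invpsi_ge0// subr_ge0.
apply: He; rewrite /ball/= distrC gtr0_norm ?subr_gt0//.
by rewrite ltrBlDl.
Qed.

(** * The Laplace transform of an arbitrary transition density *)

Section laplace_transform.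
Variable h : R -> R -> R.
Hypothesis td : transition_density_from_0 beta gamma mu h.

Let h_dt (x t : R) : 0 < x -> 0 < t -> is_derive t 1 (h x) (derive1 (h x) t).
Proof.
by move=> x0 t0; have [[d _ _] _] := td_regular td x0 t0; exact: derivable_is_derive.
Qed.

Let h_dx (x t : R) : 0 < x -> 0 < t -> is_derive x 1 (h ^~ t) (derive1 (h ^~ t) x).
Proof.
by move=> x0 t0; have [[_ d _] _] := td_regular td x0 t0; exact: derivable_is_derive.
Qed.

Let h_dxx (x t : R) : 0 < x -> 0 < t ->
  is_derive x 1 (fun y => derive1 (h ^~ t) y) (derive1n 2 (h ^~ t) x).
Proof.
by move=> x0 t0; have [[_ _ d] _] := td_regular td x0 t0; exact: derivable_is_derive.
Qed.

Let h_cont v : continuous_on_strip v h.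
Proof.
by move=> x t x0 /andP[t0 _]; have [_ [c _ _ _]] := td_regular td x0 t0.
Qed.

Let ht_cont v : continuous_on_strip v (fun x t => derive1 (h x) t).
Proof.
by move=> x t x0 /andP[t0 _]; have [_ [_ c _ _]] := td_regular td x0 t0.
Qed.

Let h_pde (x t : R) : 0 < x -> 0 < t -> derive1 (h x) t =
  - (beta * h x t + (beta * x + gamma * mu) * derive1 (h ^~ t) x)
  + 2 * mu * derive1 (h ^~ t) x + mu * x * derive1n 2 (h ^~ t) x.
Proof.
move=> x0 t0; have fp := td_fokker_planck td x0 t0.
have d1 (y : R) (y0 : 0 < y) := h_dx y0 t0.
have d2 (y : R) (y0 : 0 < y) := h_dxx y0 t0.
have e1 := @derive1_drift R (h ^~ t) (fun y => derive1 (h ^~ t) y) d1 beta (gamma * mu) x x0.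
have e2 := @derive1n2_diffusion R (h ^~ t) (fun y => derive1 (h ^~ t) y)
  (fun y => derive1n 2 (h ^~ t) y) d1 d2 mu x x0.
rewrite fp [X in - X + _ = _]e1 [X in _ + _ * X = _]e2.
by move: (derive1n 2 (h ^~ t) x) (derive1 (h ^~ t) x) => D2 D1; field.
Qed.

Let h_ge0 (x t : R) : 0 < x -> 0 < t -> 0 <= h x t.
Proof. by move=> x0 t0; have [_ h0 _] := td_density td t0; exact: h0. Qed.

Let pos_of (x : R) : Rpos x -> 0 < x. Proof. by rewrite /= in_itv/= andbT. Qed.

Lemma transition_density_integrable (t : R) : 0 < t -> leb.-integrable Rpos (EFin \o (h ^~ t)).
Proof.
move=> t0; have [mh h0 h1] := td_density td t0.
apply/integrableP; split; first exact/measurable_EFinP.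
under eq_integral => x do [rewrite inE => /pos_of x0; rewrite /= ger0_norm ?h0//].
by rewrite h1 ltry.
Qed.
Let h_int := transition_density_integrable.

Lemma transition_density_mass (t : R) : 0 < t -> \int[leb]_(x in Rpos) h x t = 1.
Proof. by move=> t0; have [_ _ h1] := td_density td t0; rewrite /Rintegral h1. Qed.
Let h_mass := transition_density_mass.

Lemma expR_integrable (c t : R) : 0 <= c -> 0 < t ->
  leb.-integrable Rpos (EFin \o (fun x => expR (- (c * x)) * h x t)).
Proof.
move=> c0 t0.
rewrite (_ : (fun x => expR (- (c * x)) * h x t) = (fun x => h x t * expR (- (c * x)))); last first.
  by apply/funext => x; rewrite mulrC.
apply: (integrable_mul_bounded _ (h_int t0) _ (M := 1)) => //.
  apply: measurable_pos_continuous => x x0.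
  suff : {for x, continuous (fun x => expR (- (c * x)))} by [].
  by repeat continuous_step.
by move=> x /pos_of x0; rewrite ger0_norm ?expR_ge0// expR_le1 oppr_le0 mulr_ge0// ltW.
Qed.

Lemma laplace_conserved (s T t : R) : 0 < s -> 0 < t -> t < T ->
  \int[leb]_(x in Rpos) (expR (- (s * x)) * h x T) =
  lap_b s T t * \int[leb]_(x in Rpos) (expR (- (lap_a s T t * x)) * h x t).
Proof.
move=> s0 t0 tT; have T0 := lt_trans t0 tT.
have [v Tv Hv] := laplace_window s0 T0.
have tI r : t <= r <= T -> 0 <= r <= T by move=> /andP[/(le_trans (ltW t0)) -> ->].
have := @conserved_laplace R beta gamma mu h (fun x t => derive1 (h x) t)
  (fun x t => derive1 (h ^~ t) x) (fun x t => derive1n 2 (h ^~ t) x)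
  gamma_gt0 mu_gt0 h_dt h_dx h_dxx h_cont ht_cont h_pde h_ge0 h_int h_mass
  (lap_a s T) (lap_b s T) v (s * expR (`|beta| * T)) t T t0 tT Tv
  (fun r rv => is_derive_lap_a (Hv r rv)) (fun r rv => is_derive_lap_b (Hv r rv))
  (fun r rI => lap_a_bound s0 T0 (tI r rI))
  (fun r rI => lap_b_bound s0 (proj2 (andP rI))).
have expand r : t <= r <= T ->
    \int[leb]_(x in Rpos) (lap_b s T r * (1 - expR (- (lap_a s T r * x))) * h x r) =
    lap_b s T r - lap_b s T r * \int[leb]_(x in Rpos) (expR (- (lap_a s T r * x)) * h x r).
  move=> rI; have /andP[a0 _] := lap_a_bound s0 T0 (tI r rI).
  have r0 : 0 < r by case/andP: rI => /(lt_le_trans t0).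
  have ei := expR_integrable a0 r0.
  transitivity (lap_b s T r * (\int[leb]_(x in Rpos) h x r -
      \int[leb]_(x in Rpos) (expR (- (lap_a s T r * x)) * h x r))); last first.
    by rewrite h_mass// mulrBr mulr1.
  rewrite -RintegralB//; last exact: h_int.
  rewrite -RintegralZl//; last exact: (@integrableB _ _ _ leb _ _ _ _ (h_int r0) ei).
  by apply: eq_Rintegral => x _; ring.
rewrite !expand ?lexx ?ltW//.
have -> : lap_b s T T = 1 by rewrite /lap_b subrr invpsi0 mulr0 addr0 powR1.
have -> : lap_a s T T = s by rewrite /lap_a subrr invpsi0 !mulr0 mul0r !addr0 divr1 mulr1.
rewrite mul1r => H; lra.
Qed.

(** By [laplace_conserved] the left side is [lap_b s T t] times a transform at time [t], for every
    small [t]; letting [t] decrease to 0 evaluates it. The value is (1 + s / psi(T))^(-gamma), the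
    Laplace transform of the gamma law. *)
Lemma laplace_transform (s T : R) : 0 < s -> 0 < T ->
  \int[leb]_(x in Rpos) (expR (- (s * x)) * h x T) = lap_b s T 0.
Proof.
move=> s0 T0; pose A := s * expR (`|beta| * T).
have A0 : 0 <= A by rewrite mulr_ge0 ?expR_ge0// ltW.
pose L t := \int[leb]_(x in Rpos) (expR (- (lap_a s T t * x)) * h x t).
have L1 : L t @[t --> 0^'+] --> (1 : R).
  (* The rate [lap_a s T t] moves with [t], so the initial condition is applied to a fixed function
     lying below the moving exponential, which is itself at most 1. The absolute value makes this
     function bounded on the whole line, as weak convergence asks. *)
  have := @td_initial _ _ _ _ _ td (fun x => expR (- (A * `|x|))).
  have cf : continuous (fun x : R => expR (- (A * `|x|))).
    move=> x; suff : {for x, continuous (fun x : R => expR (- (A * `|x|)))} by [].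
    have c1 : {for x, continuous (fun x : R => `|x|)} by exact: norm_continuous.
    by repeat continuous_step.
  move=> /(_ cf); rewrite normr0 mulr0 oppr0 expR0 => lim1.
  have bnd : exists M : R, forall x : R, `|expR (- (A * `|x|))| <= M.
    by exists 1 => x; rewrite ger0_norm ?expR_ge0// expR_le1 oppr_le0 mulr_ge0.
  have lim2 := lim1 bnd.
  have lim3 : (fun=> 1 : R) t @[t --> (0 : R)^'+] --> (1 : R) by exact: cvg_cst.
  refine (@squeeze_cvgr _ _ _ _ _ _ L _ 1 lim2 lim3).
  near=> t.
  have t0 : 0 < t by near: t; exact: nbhs_right_gt.
  have tT : t < T by near: t; exact: nbhs_right_lt.
  have /andP[a0 aA] : 0 <= lap_a s T t <= A by apply: lap_a_bound => //; rewrite !ltW.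
  have ei := expR_integrable a0 t0; have Ai := expR_integrable A0 t0.
  apply/andP; split; last first.
    rewrite -[leRHS](h_mass t0); apply: le_Rintegral => //; first exact: h_int.
    by move=> x /pos_of x0; rewrite ler_piMl ?h_ge0// expR_le1 oppr_le0 mulr_ge0// ltW.
  rewrite (_ : \int[leb]_(x in Rpos) (expR (- (A * `|x|)) * h x t) =
     \int[leb]_(x in Rpos) (expR (- (A * x)) * h x t)); last first.
    by apply: eq_Rintegral => x; rewrite inE => /pos_of x0; rewrite gtr0_norm.
  apply: le_Rintegral => // x /pos_of x0.
  by rewrite ler_wpM2r ?h_ge0// ler_expR lerN2 ler_wpM2r// ltW.
have b1 : lap_b s T t @[t --> 0^'+] --> lap_b s T 0.
  apply: cvg_at_right_filter.
  apply: is_derive_continuous; apply: is_derive_lap_b.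
  by rewrite subr0 ltr_pwDl// mulr_ge0 ?(ltW s0)// ltW// invpsi_gt0.
have P : lap_b s T t * L t @[t --> 0^'+] --> lap_b s T 0 * 1 by exact: cvgM.
rewrite mulr1 in P; rewrite -(cvg_lim (@Rhausdorff R) P).
symmetry; apply: (cvg_lim (@Rhausdorff R)).
apply: (cvg_trans (near_eq_cvg _) (cvg_cst _)).
near=> t; rewrite /= (@laplace_conserved s T t)//.
Unshelve. all: by end_near. Qed.

End laplace_transform.

Lemma transition_density_unique (h1 h2 : R -> R -> R) :
  transition_density_from_0 beta gamma mu h1 ->
  transition_density_from_0 beta gamma mu h2 ->
  forall x t : R, 0 < x -> 0 < t -> h1 x t = h2 x t.
Proof.
move=> td1 td2 x t x0 t0; apply/eqP; rewrite -subr_eq0; apply/eqP.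
have i1 := transition_density_integrable td1 t0.
have i2 := transition_density_integrable td2 t0.
apply: (@laplace_injective _ (fun x => h1 x t - h2 x t)) => //.
- exact: (@integrableB _ _ _ leb _ _ _ _ i1 i2).
- move=> y y0; have [[_ d1 _] _] := td_regular td1 y0 t0.
  have [[_ d2 _] _] := td_regular td2 y0 t0.
  have c1 := is_derive_continuous (derivable_is_derive d1).
  have c2 := is_derive_continuous (derivable_is_derive d2).
  by repeat continuous_step.
- move=> n.
  have e1 := expR_integrable td1 (ler0n R n) t0.
  have e2 := expR_integrable td2 (ler0n R n) t0.
  transitivity (\int[leb]_(x in Rpos) (expR (- (n%:R * x)) * h1 x t)
     - \int[leb]_(x in Rpos) (expR (- (n%:R * x)) * h2 x t)).
    rewrite -RintegralB//.
    apply: eq_Rintegral => y _; by rewrite -expRM_natl mulrN; ring.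
  (* The argument 0 is not covered by [laplace_transform]; there both integrals are the total
     mass. *)
  case: n {e1 e2} => [|n]; last by
    rewrite (laplace_transform td1)// (laplace_transform td2)// subrr.
  under eq_Rintegral do rewrite mul0r oppr0 expR0 mul1r.
  under [X in _ - X]eq_Rintegral do rewrite mul0r oppr0 expR0 mul1r.
  by rewrite (transition_density_mass td1)// (transition_density_mass td2)// subrr.
Qed.

End uniqueness.

Theorem proposition6p3 (R : realType) (beta gamma mu : R)
    (gamma_gt0 : 0 < gamma) (mu_gt0 : 0 < mu) (h : R -> R -> R) :
  transition_density_from_0 beta gamma mu h <->
  (forall x t : R, 0 < x -> 0 < t ->
     h x t = psi beta mu t `^ gamma / Gamma gamma
             * x `^ (gamma - 1) * expR (- (x * psi beta mu t))).
Proof.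
(* Stated for any function that agrees with the formula on the quadrant, since it is used twice: for
   [h] itself in the converse, and for [gdens] as the second solution in the comparison. *)
have existence (g : R -> R -> R) :
    (forall x t : R, 0 < x -> 0 < t -> g x t = gdens beta gamma mu x t) ->
    transition_density_from_0 beta gamma mu g.
  move=> gE; split.
  - exact: (gamma_density gamma_gt0 mu_gt0 gE).
  - exact: (gamma_C21 gamma_gt0 mu_gt0 gE).
  - exact: (gamma_fokker_planck gamma_gt0 mu_gt0 gE).
  - exact: (gamma_zero_flux gamma_gt0 gE).
  - exact: (gamma_starts_at_0 gamma_gt0 mu_gt0 gE).
split=> [td|hE]; last exact: existence.
exact: (transition_density_unique gamma_gt0 mu_gt0 td (existence _ (fun x t _ _ => erefl))).
Qed.
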